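(* Let $p>3$ be a prime. Then $$\left(\frac{-1}p\right)\sum_{k=0}^{p-1}\frac{k\binom{2k}k^3}{(-64)^k}(H_{2k}-H_k)-\frac16\equiv\begin{cases}-(3q_p(2)+2)x^2/3\pmod p&\text{if } p=x^2+2y^2\ (x,y\in\mathbb Z),\\0\pmod p&\text{if } p\equiv 5,7\pmod 8.\end{cases}$$ When $p\equiv 1\pmod 4$ and $p=x^2+y^2$ with $x$ odd and $y$ even, we have $$\sum_{k=0}^{p-1}\frac{k\binom{2k}k^3}{64^k}(H_{2k}-H_k)\equiv-\frac{x^2}3(3q_p(2)+2)\pmod p.$$
   Context: $H_k=\sum_{0<j\le k}\frac1j$ denotes the $k$-th harmonic number ($H_0=0$), and $q_p(2)=(2^{p-1}-1)/p$ is the Fermat quotient. $\left(\frac{\cdot}{p}\right)$ is the Legendre symbol. A congruence $s\equiv t\pmod p$ between rational numbers means $s-t\in p\,\mathbb Z_{(p)}$, where $\mathbb Z_{(p)}$ is the ring of rational numbers with denominator prime to $p$. *)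

(* Defs.v *)
From mathcomp Require Import all_boot all_order all_algebra.

Set Implicit Arguments.
Unset Strict Implicit.
Unset Printing Implicit Defensive.

Import GRing.Theory.

Local Open Scope ring_scope.

Definition harmonic (n : nat) : rat := \sum_(1 <= j < n.+1) j%:R^-1.

Definition fermat_quotient (p a : nat) : rat := (a%:R ^+ p.-1 - 1) / p%:R.

(* The Legendre symbol when p is an odd prime; b ranges over the residues
   0, ..., p - 1. *)
Definition legendre (a : int) (p : nat) : int :=
  if (p%:Z %| a)%Z then 0
  else if [exists b : 'I_p, (b%:Z ^+ 2 == a %[mod p%:Z])%Z] then 1
  else -1.

(* For p prime, the subring Z_(p) of the rationals: denq r is the denominator
   of r in lowest terms. *)
Definition Zloc (p : nat) : pred rat := [pred r | coprime `|denq r|%N p].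

Definition eqmod_loc (p : nat) (s t : rat) : Prop :=
  exists2 r : rat, r \in Zloc p & s - t = p%:R * r.

(* Main.v *)
Require Import Defs.
From mathcomp Require Import all_boot all_order all_algebra.
From mathcomp Require Import all_fingroup all_solvable all_field.
From mathcomp Require Import zify ring.

(* Write p = 2n + 1.  Modulo p, 'C(2k, k) = (-4)^k 'C(n, k) and
     2 (H_{2k} - H_k) = (H_{n-k} - H_k) - H_n,   H_n = - 2 q_p(2),
   so both sums become weighted sums of k 'C(n, k)^3 (H_{n-k} - H_k) and of
   k 'C(n, k)^3.  The reflection k -> n - k evaluates the second kind in terms of
   the Franel number f_n = sum 'C(n, k)^3 and of Dixon's alternating sum g_n.  For
   the first kind, 'C(n, k)^3 (2 + 3 (2k - n) (H_{n-k} - H_k)) is the derivative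
   at x = k of (2x - n) 'C(n, x)^3; differentiating Zeilberger's telescoping
   relations for this very-well-poised term in x shows that its sum is 2 (-1)^n
   (Paule-Schneider), and that its alternating sum, for n even, satisfies a
   first-order recurrence whose coefficients pick up a factor p.  It remains to
   know f_n and g_n modulo p.

   Dixon's formula and Wilson's theorem give g_n = 'C(2m, m)^2 for p = 4m + 1.
   MacMahon's quadratic formula rewrites f_n as 2^n sum_j 'C(n, 2j) 'C(n+j, j)
   'C(2j, j) / 4^j, which modulo p is termwise 2^n times a terminating Watson 3F2
   attached to N = floor(p / 4): it vanishes for N odd (p = 5, 7 mod 8) and equals
   'C(n, m)^2 for N = 2m.

   Finally the binomials are related to quadratic forms through Jacobsthal sums
   J(a) = sum_t chi(t) chi(t^k + a) over a finite field with q elements.  Their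
   second moment over a gives q = A^2 + B^2 (k = 2) or q = A^2 + 2 B^2 (k = 4) with
   2A = J(1) or 2A = J(1) / 2, and expanding chi(x) = x^((q-1)/2) identifies J(1)
   with a binomial coefficient modulo p.  For p = 3 mod 8 the quartic sums
   over F_p all vanish; one works over F_{p^2} and comes back with Lucas' theorem. *)

Set Implicit Arguments.
Unset Strict Implicit.
Unset Printing Implicit Defensive.

Import Order.TTheory GRing.Theory Num.Theory.

Local Open Scope ring_scope.

(** * Hypergeometric sums *)

Section HypergeometricSums.
Variable F : fieldType.

(** Takes the place of characteristic zero, so that the identities below also apply in
    characteristic p to indices below p. *)
Definition natr_unit_upto (n : nat) :=
  forall j, (0 < j <= n)%N -> j%:R != 0 :> F.

Definition harm (n : nat) : F := \sum_(1 <= j < n.+1) j%:R^-1.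

Lemma harmS n : harm n.+1 = harm n + n.+1%:R^-1.
Proof. by rewrite /harm big_nat_recr. Qed.

Lemma harm0 : harm 0 = 0.
Proof. by rewrite /harm big_nil. Qed.

(* [dbin n k] is the derivative of [log 'C(n, x)] at [x = k]. *)
Definition dbin (n k : nat) : F := harm (n - k) - harm k.

Lemma natr_bin_down n k :
  n.+1%:R * 'C(n, k)%:R = (n.+1%:R - k%:R) * 'C(n.+1, k)%:R :> F.
Proof.
have [lekn | ltnk] := leqP k n.+1; last first.
  by rewrite !bin_small ?mulr0 //; lia.
by rewrite -natrB // -!natrM mul_bin_down.
Qed.

Lemma natr_bin_diag n k :
  n.+1%:R * 'C(n, k)%:R = k.+1%:R * 'C(n.+1, k.+1)%:R :> F.
Proof. by rewrite -!natrM mul_bin_diag. Qed.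

Lemma bin3_down n k : n.+1%:R != 0 :> F ->
  'C(n, k)%:R ^+ 3 = 'C(n.+1, k)%:R ^+ 3 * (n.+1%:R - k%:R) ^+ 3 / n.+1%:R ^+ 3 :> F.
Proof.
move=> nz; apply: (mulfI (expf_neq0 3 nz)); rewrite -exprMn natr_bin_down.
by field; rewrite nat1r.
Qed.

(** One third of the derivative in k of [bin3_down]. At [k = n.+1], where [n - k] is truncated, both
    sides vanish. *)
Lemma bin3_dbin_down n k : natr_unit_upto n.+1 -> (k <= n.+1)%N ->
  'C(n, k)%:R ^+ 3 * dbin n k =
  'C(n.+1, k)%:R ^+ 3 *
    ((n.+1%:R - k%:R) ^+ 3 * dbin n.+1 k - (n.+1%:R - k%:R) ^+ 2) / n.+1%:R ^+ 3.
Proof.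
move=> nz; have nz1 : n.+1%:R != 0 :> F by apply: nz; lia.
rewrite leq_eqVlt => /predU1P[-> | ltkn].
  by rewrite bin_small // subrr; field; rewrite nat1r.
rewrite (bin3_down _ nz1) /dbin subSn // harmS.
have nzk : (n - k).+1%:R != 0 :> F by apply: nz; lia.
have -> : n.+1%:R - k%:R = (n - k).+1%:R :> F.
  by rewrite -natrB ?(ltnW ltkn) // subSn.
by field; rewrite !nat1r nz1 nzk.
Qed.

Lemma bin3_diag n k :
  k.+1%:R ^+ 3 * 'C(n.+1, k.+1)%:R ^+ 3 = n.+1%:R ^+ 3 * 'C(n, k)%:R ^+ 3 :> F.
Proof. by rewrite -!exprMn natr_bin_diag. Qed.

(** One third of the derivative in k of [bin3_diag]. *)
Lemma bin3_dbin_diag n k : natr_unit_upto n.+1 -> (k <= n)%N ->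
  'C(n.+1, k.+1)%:R ^+ 3 * (k.+1%:R ^+ 3 * dbin n.+1 k.+1 + k.+1%:R ^+ 2) =
  n.+1%:R ^+ 3 * 'C(n, k)%:R ^+ 3 * dbin n k.
Proof.
move=> nz lekn; rewrite -bin3_diag /dbin subSS harmS.
have nzk : k.+1%:R != 0 :> F by apply: nz; lia.
by field; rewrite nat1r.
Qed.


(** Keeping the shifted certificate as a separate expression [G'] lets one rational identity cover
    the last index [k = N] too, where [G'] supplies the boundary zero. *)
Lemma telescope_shift (N : nat) (t G G' : nat -> F) :
    G 0 = 0 -> G' N = 0 -> (forall k, (k < N)%N -> G' k = G k.+1) ->
    (forall k, (k <= N)%N -> t k = G' k - G k) ->
  \sum_(0 <= k < N.+1) t k = 0.
Proof.
move=> G0 G'N GS tG.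
rewrite big_nat_recr //= tG // G'N sub0r.
under eq_big_nat => k /andP[_ ltkN] do rewrite tG ?(ltnW ltkN) // GS //.
by rewrite telescope_sumr // G0 subr0 subrr.
Qed.

(* The derivative of [(2 x - n) * 'C(n, x) ^ 3] at [x = k]. *)
Definition wp_term (n k : nat) : F :=
  'C(n, k)%:R ^+ 3 * (2 + 3 * (2 * k%:R - n%:R) * dbin n k).

(* Here and below, [q] is a certificate found by Zeilberger's algorithm:
   [G k] is [k ^ 3 * q k * 'C(N, k) ^ 3] up to a constant (or its derivative in [k]),
   and [G'] is an expression for [k => G k.+1] that also makes sense at [k = N]. *)
Lemma sum_wp_termS n : natr_unit_upto n.+1 ->
  \sum_(0 <= k < n.+2) wp_term n.+1 k =
  - \sum_(0 <= k < n.+1) wp_term n k.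
Proof.
move=> nz; have nz1 : n.+1%:R != 0 :> F by apply: nz; lia.
apply/eqP; rewrite -addr_eq0; apply/eqP.
have -> : \sum_(0 <= k < n.+1) wp_term n k =
          \sum_(0 <= k < n.+2) wp_term n k.
  by rewrite [RHS]big_nat_recr //= /wp_term bin_small // expr0n mul0r addr0.
rewrite -big_split /=.
pose q (k : F) := k - 2 * n.+1%:R.
pose G k := 'C(n.+1, k)%:R ^+ 3 / n.+1%:R ^+ 3 *
  (k%:R ^+ 3 + 3 * k%:R ^+ 2 * q k%:R + 3 * q k%:R * k%:R ^+ 3 * dbin n.+1 k).
pose G' k := 'C(n, k)%:R ^+ 3 + 3 * q k.+1%:R * ('C(n, k)%:R ^+ 3 * dbin n k).
apply: (@telescope_shift n.+1 _ G G').
- by rewrite /G mulr0n; ring.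
- by rewrite /G' bin_small // mulr0n; ring.
- move=> k lekn; rewrite /G' /G.
  set A := _ ^+ 3 * dbin n k; set B := _ ^+ 3.
  have -> : A = 'C(n.+1, k.+1)%:R ^+ 3 *
     (k.+1%:R ^+ 3 * dbin n.+1 k.+1 + k.+1%:R ^+ 2) / n.+1%:R ^+ 3.
    by rewrite bin3_dbin_diag // /A; field; rewrite nat1r.
  have -> : B = k.+1%:R ^+ 3 * 'C(n.+1, k.+1)%:R ^+ 3 / n.+1%:R ^+ 3.
    by rewrite bin3_diag /B; field; rewrite nat1r.
  by field; rewrite nat1r.
- move=> k lekn; rewrite /G' /G /wp_term.
  rewrite ['C(n, k)%:R ^+ 3 * (2 + _)]mulrDr.
  rewrite [X in _ + (_ + X) = _]mulrCA.
  rewrite bin3_dbin_down // bin3_down // /q.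
  by field; rewrite nat1r.
Qed.

Lemma bin3_down2 n k : n.+1%:R != 0 :> F -> n.+2%:R != 0 :> F ->
  'C(n, k)%:R ^+ 3 =
  'C(n.+2, k)%:R ^+ 3 * ((n.+2%:R - k%:R) * (n.+1%:R - k%:R)) ^+ 3 /
    (n.+1%:R * n.+2%:R) ^+ 3 :> F.
Proof.
move=> nz1 nz2; rewrite (bin3_down _ nz1) (bin3_down _ nz2).
by field; rewrite nat1r -natrD add2n nz1 nz2.
Qed.

Lemma bin3_dbin_down2 n k : natr_unit_upto n.+2 -> (k <= n.+2)%N ->
  'C(n, k)%:R ^+ 3 * dbin n k =
  'C(n.+2, k)%:R ^+ 3 *
    (((n.+2%:R - k%:R) * (n.+1%:R - k%:R)) ^+ 3 * dbin n.+2 k -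
     (n.+2%:R - k%:R) ^+ 2 * (n.+1%:R - k%:R) ^+ 2 *
       (n.+2%:R - k%:R + (n.+1%:R - k%:R))) / (n.+1%:R * n.+2%:R) ^+ 3.
Proof.
move=> nz.
have nz1 : n.+1%:R != 0 :> F by apply: nz; lia.
have nz2 : n.+2%:R != 0 :> F by apply: nz; lia.
rewrite leq_eqVlt => /predU1P[-> | ltkn].
  by rewrite bin_small // subrr; field; rewrite nat1r -natrD add2n nz1 nz2.
rewrite bin3_dbin_down //; last by move=> j ?; apply: nz; lia.
rewrite mulrBr mulrCA bin3_dbin_down // ?(bin3_down _ nz2); last by lia.
by field; rewrite nat1r -natrD add2n nz1 nz2.
Qed.

Definition alt_wp_term (n k : nat) : F := (-1) ^+ k * wp_term n k.

(** What matters later is the factor (3n+1)(3n+5): when (p-1)/2 is even, p divides it for some even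
    n below (p-1)/2. *)
Lemma sum_alt_wp_termSS n : natr_unit_upto n.+2 ->
  n.+1%:R ^+ 2 * (\sum_(0 <= k < n.+3) alt_wp_term n.+2 k) +
  3 * (3 * n%:R + 1) * (3 * n%:R + 5) * (\sum_(0 <= k < n.+1) alt_wp_term n k) = 0.
Proof.
move=> nz.
have nz1 : n.+1%:R != 0 :> F by apply: nz; lia.
have nz2 : n.+2%:R != 0 :> F by apply: nz; lia.
have -> : \sum_(0 <= k < n.+1) alt_wp_term n k =
          \sum_(0 <= k < n.+3) alt_wp_term n k.
  rewrite [RHS]big_nat_recr // [X in _ = X + _]big_nat_recr //=.
  by rewrite /alt_wp_term /wp_term !bin_small // expr0n !mul0r !mulr0 !addr0.
rewrite !big_distrr /= -big_split /=.
pose c5 : F := - 18 * n%:R - 30.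
pose c4 : F := 99 * n%:R ^+ 2 + 318 * n%:R + 255.
pose c3 : F := - 219 * n%:R ^+ 3 - 1046 * n%:R ^+ 2 - 1651 * n%:R - 860.
pose c2 : F := 243 * n%:R ^+ 4 + 1548 * n%:R ^+ 3 + 3651 * n%:R ^+ 2 +
  3774 * n%:R + 1440.
pose c1 : F := - 134 * n%:R ^+ 5 - 1075 * n%:R ^+ 4 - 3395 * n%:R ^+ 3 -
  5270 * n%:R ^+ 2 - 4015 * n%:R - 1199.
pose c0 : F := 28 * n%:R ^+ 6 + 276 * n%:R ^+ 5 + 1110 * n%:R ^+ 4 +
  2330 * n%:R ^+ 3 + 2690 * n%:R ^+ 2 + 1618 * n%:R + 396.
pose q (x : F) := c5 * x ^+ 5 + c4 * x ^+ 4 + c3 * x ^+ 3 + c2 * x ^+ 2 + c1 * x + c0.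
pose q' (x : F) := 5 * c5 * x ^+ 4 + 4 * c4 * x ^+ 3 + 3 * c3 * x ^+ 2 + 2 * c2 * x + c1.
pose G k := (-1) ^+ k * ('C(n.+2, k)%:R ^+ 3 / (n.+1%:R * n.+2%:R) ^+ 3 *
  (k%:R ^+ 3 * q' k%:R + 3 * k%:R ^+ 2 * q k%:R +
   3 * q k%:R * k%:R ^+ 3 * dbin n.+2 k)).
pose G' k := - (-1) ^+ k * (q' k.+1%:R * 'C(n.+1, k)%:R ^+ 3 +
  3 * q k.+1%:R * ('C(n.+1, k)%:R ^+ 3 * dbin n.+1 k)) / n.+1%:R ^+ 3.
apply: (@telescope_shift n.+2 _ G G').
- by rewrite /G mulr0n; ring.
- by rewrite /G' bin_small // mulr0n; ring.
- move=> k lekn; rewrite /G' /G.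
  set A := _ ^+ 3 * dbin n.+1 k; set B := 'C(n.+1, k)%:R ^+ 3.
  have -> : A = 'C(n.+2, k.+1)%:R ^+ 3 *
     (k.+1%:R ^+ 3 * dbin n.+2 k.+1 + k.+1%:R ^+ 2) / n.+2%:R ^+ 3.
    by rewrite bin3_dbin_diag // /A; field; rewrite -natrD add2n.
  have -> : B = k.+1%:R ^+ 3 * 'C(n.+2, k.+1)%:R ^+ 3 / n.+2%:R ^+ 3.
    by rewrite bin3_diag /B; field; rewrite -natrD add2n.
  move: (q _) (q' _) => qk qk'; rewrite [(-1) ^+ k.+1]exprS.
  by field; rewrite nat1r -natrD add2n nz1 nz2.
- move=> k lekn; rewrite /G' /G /alt_wp_term /wp_term.
  rewrite 2!['C(_, k)%:R ^+ 3 * (2 + _)]mulrDr.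
  rewrite [X in _ + _ * (_ * (_ + X)) = _]mulrCA.
  rewrite bin3_dbin_down // bin3_dbin_down2 // (@bin3_down n.+1) // (@bin3_down2 n) //.
  rewrite /q /q' /c0 /c1 /c2 /c3 /c4 /c5.
  by field; rewrite nat1r -natrD add2n nz1 nz2.
Qed.

(** * Dixon's alternating sum of cubes *)

Lemma natr_bin_right n k :
  k.+1%:R * 'C(n, k.+1)%:R = (n%:R - k%:R) * 'C(n, k)%:R :> F.
Proof.
have [lekn | ltnk] := leqP k n; last by rewrite !bin_small ?mulr0 //; lia.
by rewrite -natrB // -!natrM mul_bin_left.
Qed.

Definition dixon_sum n : F := \sum_(0 <= k < n.+1) (-1) ^+ k * 'C(n, k)%:R ^+ 3.

(** First order in steps of two, so g_0 determines every g_{2m}; Dixon's product formula is proved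
    from it. *)
Lemma dixon_sumSS n : n.+1%:R != 0 :> F -> n.+2%:R != 0 :> F ->
  n.+2%:R ^+ 2 * dixon_sum n.+2 +
  3 * (3 * n%:R + 2) * (3 * n%:R + 4) * dixon_sum n = 0.
Proof.
move=> nz1 nz2; rewrite /dixon_sum.
have -> : \sum_(0 <= k < n.+1) (-1) ^+ k * 'C(n, k)%:R ^+ 3 =
          \sum_(0 <= k < n.+3) (-1) ^+ k * 'C(n, k)%:R ^+ 3 :> F.
  rewrite [RHS]big_nat_recr // [X in _ = X + _]big_nat_recr //=.
  by rewrite !bin_small // expr0n !mulr0 !addr0.
rewrite !big_distrr /= -big_split /=.
pose c4 : F := - 9 * n%:R - 12.
pose c3 : F := 45 * n%:R ^+ 2 + 132 * n%:R + 96.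
pose c2 : F := - 87 * n%:R ^+ 3 - 396 * n%:R ^+ 2 - 594 * n%:R - 294.
pose c1 : F := 78 * n%:R ^+ 4 + 483 * n%:R ^+ 3 + 1107 * n%:R ^+ 2 + 1113 * n%:R + 414.
pose c0 : F := - 28 * n%:R ^+ 5 - 220 * n%:R ^+ 4 - 682 * n%:R ^+ 3 -
  1042 * n%:R ^+ 2 - 784 * n%:R - 232.
pose q (x : F) := c4 * x ^+ 4 + c3 * x ^+ 3 + c2 * x ^+ 2 + c1 * x + c0.
pose G k := (-1) ^+ k *
  ((k%:R * 'C(n.+2, k)%:R) ^+ 3 * q k%:R / (n.+1%:R * n.+2%:R) ^+ 3).
pose G' k := - (-1) ^+ k * (((n.+2%:R - k%:R) * 'C(n.+2, k)%:R) ^+ 3 *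
  q k.+1%:R / (n.+1%:R * n.+2%:R) ^+ 3).
apply: (@telescope_shift n.+2 _ G G').
- by rewrite /G mul0r expr0n /= !mul0r mulr0.
- by rewrite /G' subrr mul0r expr0n /= !mul0r mulr0.
- by move=> k ltkn; rewrite /G' /G natr_bin_right [(-1) ^+ k.+1]exprS mulN1r.
- move=> k lekn; rewrite /G' /G (@bin3_down2 n) //.
  rewrite /q /c0 /c1 /c2 /c3 /c4.
  by field; rewrite nat1r -natrD add2n nz1 nz2.
Qed.

(** * Franel numbers and MacMahon's quadratic formula *)

Definition franel n : F := \sum_(0 <= k < n.+1) 'C(n, k)%:R ^+ 3.

(** Franel's three-term recurrence, which serves to compare f_n with MacMahon's sum. *)
Lemma franelSS n : n.+1%:R != 0 :> F -> n.+2%:R != 0 :> F ->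
  n.+2%:R ^+ 2 * franel n.+2 =
  (7 * n.+1%:R ^+ 2 + 7 * n.+1%:R + 2) * franel n.+1 +
  8 * n.+1%:R ^+ 2 * franel n.
Proof.
move=> nz1 nz2; rewrite /franel.
have -> : \sum_(0 <= k < n.+1) 'C(n, k)%:R ^+ 3 =
          \sum_(0 <= k < n.+3) 'C(n, k)%:R ^+ 3 :> F.
  rewrite [RHS]big_nat_recr // [X in _ = X + _]big_nat_recr //=.
  by rewrite !bin_small // expr0n !addr0.
have -> : \sum_(0 <= k < n.+2) 'C(n.+1, k)%:R ^+ 3 =
          \sum_(0 <= k < n.+3) 'C(n.+1, k)%:R ^+ 3 :> F.
  by rewrite [RHS]big_nat_recr //= bin_small // expr0n addr0.
apply/eqP; rewrite -subr_eq0; apply/eqP.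
rewrite !big_distrr /= -big_split -sumrB /=.
pose c3 : F := 4 * n%:R ^+ 2 + 8 * n%:R + 4.
pose c2 : F := - 18 * n%:R ^+ 3 - 66 * n%:R ^+ 2 - 78 * n%:R - 30.
pose c1 : F := 27 * n%:R ^+ 4 + 147 * n%:R ^+ 3 + 291 * n%:R ^+ 2 + 249 * n%:R + 78.
pose c0 : F := - 14 * n%:R ^+ 5 - 102 * n%:R ^+ 4 - 290 * n%:R ^+ 3 -
  402 * n%:R ^+ 2 - 272 * n%:R - 72.
pose q (x : F) := c3 * x ^+ 3 + c2 * x ^+ 2 + c1 * x + c0.
pose G k := (k%:R * 'C(n.+2, k)%:R) ^+ 3 * q k%:R / (n.+1%:R * n.+2%:R) ^+ 3.
pose G' k := ((n.+2%:R - k%:R) * 'C(n.+2, k)%:R) ^+ 3 *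
  q k.+1%:R / (n.+1%:R * n.+2%:R) ^+ 3.
apply: (@telescope_shift n.+2 _ G G').
- by rewrite /G mul0r expr0n /= !mul0r.
- by rewrite /G' subrr mul0r expr0n /= !mul0r.
- by move=> k ltkn; rewrite /G' /G natr_bin_right.
- move=> k lekn; rewrite /G' /G (@bin3_down2 n) // (@bin3_down n.+1) //.
  rewrite /q /c0 /c1 /c2 /c3.
  by field; rewrite nat1r -natrD add2n nz1 nz2.
Qed.

Lemma central_binS k :
  k.+1%:R * 'C(2 * k.+1, k.+1)%:R = 2 * (2 * k%:R + 1) * 'C(2 * k, k)%:R :> F.
Proof.
rewrite -[X in X + 1](natrM _ 2 k) natr1 -!natrM; congr _%:R.
apply/eqP; rewrite -(eqn_pmul2l (ltn0Sn k)).
have := mul_bin_diag (2 * k).+2 k; have := mul_bin_down (2 * k).+1 k.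
rewrite /= (_ : (2 * k).+1 - k = k.+1)%N; last by lia.
by rewrite (_ : 2 * k.+1 = (2 * k).+2)%N; [nia | lia].
Qed.

(** MacMahon's summand with the overall factor 2^n left out. *)
Definition franel_quad_term (n j : nat) : F :=
  'C(n, 2 * j)%:R * 'C(n + j, j)%:R * ('C(2 * j, j)%:R / 4 ^+ j).

Definition franel_quad n : F := \sum_(0 <= j < n.+1) franel_quad_term n j.

Lemma franel_quad_term_small n j : (n < 2 * j)%N -> franel_quad_term n j = 0.
Proof. by move=> ltn2j; rewrite /franel_quad_term bin_small // !mul0r. Qed.

Lemma natr_bin_up n j :
  n.+1%:R * 'C(n.+1 + j, j)%:R = (n.+1%:R + j%:R) * 'C(n + j, j)%:R :> F.
Proof.
rewrite addSn -natrD -!natrM addSn; congr _%:R.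
by rewrite (mul_bin_down (n + j).+1) /= -addSn addnK.
Qed.

Lemma franel_quadSS n : 2 != 0 :> F -> n.+1%:R != 0 :> F -> n.+2%:R != 0 :> F ->
  4 * n.+2%:R ^+ 2 * franel_quad n.+2 =
  2 * (7 * n.+1%:R ^+ 2 + 7 * n.+1%:R + 2) * franel_quad n.+1 +
  8 * n.+1%:R ^+ 2 * franel_quad n.
Proof.
move=> nz2F nz1 nz2; rewrite /franel_quad.
have -> : \sum_(0 <= j < n.+1) franel_quad_term n j =
          \sum_(0 <= j < n.+3) franel_quad_term n j.
  rewrite [RHS]big_nat_recr // [X in _ = X + _]big_nat_recr //=.
  by rewrite !franel_quad_term_small ?addr0 ?addr0 //; lia.
have -> : \sum_(0 <= j < n.+2) franel_quad_term n.+1 j =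
          \sum_(0 <= j < n.+3) franel_quad_term n.+1 j.
  by rewrite [RHS]big_nat_recr //= franel_quad_term_small ?addr0 ?addr0 //; lia.
apply/eqP; rewrite -subr_eq0; apply/eqP.
rewrite !big_distrr /= -big_split -sumrB /=.
(* All three terms of the recurrence are rational multiples of [t j]; with [n.+2] in the first
   binomial and [n] in the second, only n+1 and n+2 occur as denominators. *)
pose t j := 'C(n.+2, 2 * j)%:R * 'C(n + j, j)%:R * ('C(2 * j, j)%:R / 4 ^+ j) : F.
pose q : F := - (72 * n%:R + 96) / (n.+1%:R * n.+2%:R).
pose G j := q * (j%:R ^+ 3 * t j).
pose G' j := q * ((n.+2%:R - 2 * j%:R) * (n.+1%:R - 2 * j%:R) *
  (n%:R + j%:R + 1) * t j / 4).
apply: (@telescope_shift n.+2 _ G G').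
- by rewrite /G expr0n /= mul0r mulr0.
- rewrite /G' /t bin_small; last by lia.
  by rewrite !mul0r mulr0 !mul0r mulr0.
- move=> j ltjn; rewrite /G' /G; congr (q * _); rewrite /t.
  have E1 := natr_bin_right n.+2 (2 * j); have E2 := natr_bin_right n.+2 (2 * j).+1.
  have E3 := natr_bin_diag (n + j) j; have E4 := central_binS j.
  rewrite (_ : 2 * j.+1 = (2 * j).+2)%N in E4 *; last by lia.
  rewrite addnS [_ ^+ j.+1]exprS.
  move: E1 E2 E3 E4.
  move: ('C(n.+2, (2 * j).+2)%:R : F) ('C(n.+2, (2 * j).+1)%:R : F) => x2 x1.
  move: ('C((n + j).+1, j.+1)%:R : F) ('C((2 * j).+2, j.+1)%:R : F) => y1 z1.
  move: ('C(n.+2, 2 * j)%:R : F) ('C(n + j, j)%:R : F) ('C(2 * j, j)%:R : F).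
  move=> x0 y0 z0 E1 E2 E3 E4.
  have -> : j.+1%:R ^+ 3 * (x2 * y1 * (z1 / (4 * 4 ^+ j))) =
     (j.+1%:R * y1) * x2 * j.+1%:R * (j.+1%:R * z1) / (4 * 4 ^+ j) by ring.
  rewrite -E3 E4.
  have -> : (n + j).+1%:R * y0 * x2 * j.+1%:R * (2 * (2 * j%:R + 1) * z0) =
     (n + j).+1%:R * y0 * ((2 * j).+1%:R * ((2 * j).+2%:R * x2)) * z0 by ring.
  rewrite E2 [(2 * j).+1%:R * _]mulrCA E1; field.
  by rewrite expf_neq0 // (natrM _ 2 2) mulf_neq0.
- move=> j lejn; rewrite /G' /G /franel_quad_term /t.
  have E1 := natr_bin_down n.+1 (2 * j); have E2 := natr_bin_down n (2 * j).
  have E3 := natr_bin_up n j; have E4 := natr_bin_up n.+1 j.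
  have -> : 'C(n, 2 * j)%:R = (n.+2%:R - 2 * j%:R) * (n.+1%:R - 2 * j%:R) *
     'C(n.+2, 2 * j)%:R / (n.+1%:R * n.+2%:R) :> F.
    apply: (mulfI nz1); rewrite E2; apply: (mulfI nz2); rewrite mulrCA E1.
    by field; rewrite nat1r -natrD add2n nz1 nz2.
  have -> : 'C(n.+1, 2 * j)%:R =
      (n.+2%:R - 2 * j%:R) * 'C(n.+2, 2 * j)%:R / n.+2%:R :> F.
    by apply: (mulfI nz2); rewrite E1; field; rewrite -natrD add2n nz2.
  have -> : 'C(n.+2 + j, j)%:R = (n.+2%:R + j%:R) * (n.+1%:R + j%:R) *
     'C(n + j, j)%:R / (n.+1%:R * n.+2%:R) :> F.
    apply: (mulfI nz2); rewrite E4; apply: (mulfI nz1); rewrite mulrCA E3.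
    by field; rewrite nat1r -natrD add2n nz1 nz2.
  have -> : 'C(n.+1 + j, j)%:R = (n.+1%:R + j%:R) * 'C(n + j, j)%:R / n.+1%:R :> F.
    by apply: (mulfI nz1); rewrite E3; field; rewrite nat1r nz1.
  rewrite /q; move: (_ / 4 ^+ j) => z; field.
  by rewrite nat1r -natrD add2n nz1 nz2 /= (natrM _ 2 2) mulf_neq0.
Qed.

(** Both sides satisfy Franel's recurrence and agree at n = 0 and n = 1. *)
Lemma franel_quadE n : 2 != 0 :> F -> natr_unit_upto n ->
  franel n = 2 ^+ n * franel_quad n.
Proof.
move=> nz2F; elim/ltn_ind: n => -[|[|n]] IH nz.
- rewrite /franel /franel_quad !big_nat1 /franel_quad_term muln0 !bin0.
  by rewrite !expr0 expr1n divr1 !mulr1.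
- rewrite /franel /franel_quad 2?big_nat_recr //= 2?big_nat_recr //= !big_nil.
  rewrite (@franel_quad_term_small 1 1) // /franel_quad_term muln0 !bin0 binn.
  by rewrite expr0 divr1; ring.
have nz1 : n.+1%:R != 0 :> F by apply: nz; lia.
have nz2 : n.+2%:R != 0 :> F by apply: nz; lia.
apply: (mulfI (expf_neq0 2 nz2)); rewrite franelSS //.
rewrite !IH //; try (by move=> j ?; apply: nz; lia).
transitivity (2 ^+ n * (4 * n.+2%:R ^+ 2 * franel_quad n.+2)).
  by rewrite franel_quadSS // [2 ^+ n.+1]exprS; ring.
by rewrite [2 ^+ n.+2]exprS [2 ^+ n.+1]exprS; ring.
Qed.

(** The k-th term (-n)_k (n+1)_k (1/2)_k / k!^3 of 3F2(-n, n+1, 1/2; 1, 1; 1), an instance of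
    Watson's theorem. *)
Definition watson_sum_term (n k : nat) : F :=
  'C(n, k)%:R * 'C(n + k, k)%:R * ('C(2 * k, k)%:R * (- 4^-1) ^+ k).

Lemma watson_sum_term_small n k : (n < k)%N -> watson_sum_term n k = 0.
Proof. by move=> ltnk; rewrite /watson_sum_term bin_small // !mul0r. Qed.

Definition watson_sum n : F := \sum_(0 <= k < n.+1) watson_sum_term n k.

(** The recurrence skips one index, so the parities separate: odd indices inherit the value 0 at n =
    1, even ones a product formula. *)
Lemma watson_sumSS n : 2 != 0 :> F -> n.+1%:R != 0 :> F -> n.+2%:R != 0 :> F ->
  n.+2%:R ^+ 2 * watson_sum n.+2 = n.+1%:R ^+ 2 * watson_sum n.
Proof.
move=> nz2F nz1 nz2; rewrite /watson_sum.
have -> : \sum_(0 <= k < n.+1) watson_sum_term n k =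
          \sum_(0 <= k < n.+3) watson_sum_term n k.
  rewrite [RHS]big_nat_recr // [X in _ = X + _]big_nat_recr //=.
  by rewrite !watson_sum_term_small ?addr0 ?addr0.
apply/eqP; rewrite -subr_eq0; apply/eqP.
rewrite !big_distrr /= -sumrB /=.
pose t k := 'C(n.+2, k)%:R * 'C(n + k, k)%:R * ('C(2 * k, k)%:R * (- 4^-1) ^+ k) : F.
pose q : F := - (4 * n%:R + 6) / (n.+1%:R * n.+2%:R).
pose G k := q * (k%:R ^+ 3 * t k).
pose G' k := q * (- (n.+2%:R - k%:R) * (n%:R + k%:R + 1) * (2 * k%:R + 1) * t k / 2).
apply: (@telescope_shift n.+2 _ G G').
- by rewrite /G expr0n /= mul0r mulr0.
- by rewrite /G' subrr oppr0 !mul0r mulr0.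
- move=> k ltkn; rewrite /G' /G; congr (q * _); rewrite /t.
  have E1 := natr_bin_right n.+2 k.
  have E3 := natr_bin_diag (n + k) k; have E4 := central_binS k.
  rewrite addnS [_ ^+ k.+1]exprS.
  transitivity ((k.+1%:R * 'C(n.+2, k.+1)%:R) *
    (k.+1%:R * 'C((n + k).+1, k.+1)%:R) *
    (k.+1%:R * 'C(2 * k.+1, k.+1)%:R) * (- 4^-1) * (- 4^-1) ^+ k : F); last by ring.
  rewrite E1 -E3 E4; move: ((- 4^-1) ^+ k) => e; field.
  by rewrite nz2F (natrM _ 2 2) mulf_neq0.
- move=> k lekn; rewrite /G' /G /watson_sum_term /t.
  have E1 := natr_bin_down n.+1 k; have E2 := natr_bin_down n k.
  have E3 := natr_bin_up n k; have E4 := natr_bin_up n.+1 k.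
  have -> : 'C(n, k)%:R = (n.+2%:R - k%:R) * (n.+1%:R - k%:R) *
     'C(n.+2, k)%:R / (n.+1%:R * n.+2%:R) :> F.
    apply: (mulfI nz1); rewrite E2; apply: (mulfI nz2); rewrite mulrCA E1.
    by field; rewrite nat1r -natrD add2n nz1 nz2.
  have -> : 'C(n.+2 + k, k)%:R = (n.+2%:R + k%:R) * (n.+1%:R + k%:R) *
     'C(n + k, k)%:R / (n.+1%:R * n.+2%:R) :> F.
    apply: (mulfI nz2); rewrite E4; apply: (mulfI nz1); rewrite mulrCA E3.
    by field; rewrite nat1r -natrD add2n nz1 nz2.
  rewrite /q; move: (_ * (- 4^-1) ^+ k) => z; field.
  by rewrite nat1r -natrD add2n nz1 nz2.
Qed.

End HypergeometricSums.

(** * Jacobsthal sums over a finite field *)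

Lemma sum_periodic (V : zmodType) (h : nat -> V) (a b : nat) :
    (forall i, h (a + i)%N = h i) ->
  \sum_(0 <= i < b * a) h i = (\sum_(0 <= i < a) h i) *+ b.
Proof.
move=> hP; elim: b => [|b IH]; first by rewrite mul0n big_nil.
rewrite mulSn (@big_cat_nat _ _ _ a) ?leq_addr //= mulrS -IH; congr (_ + _).
rewrite -{1}[a]add0n big_addn addKn.
by apply: eq_bigr => i _; rewrite addnC hP.
Qed.

Section FiniteFieldCharacterSums.
Variables (F : finFieldType) (k M : nat).
Hypotheses (k_gt0 : (0 < k)%N) (M_gt0 : (0 < M)%N).
Hypothesis cardF : #|F| = (2 * (k * M)).+1.

Let n := (k * M)%N.
Let n_gt0 : (0 < n)%N. Proof. by rewrite muln_gt0 k_gt0. Qed.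

Lemma expf_order (x : F) : x != 0 -> x ^+ (2 * n) = 1.
Proof.
by move=> nzx; apply: (mulfI nzx); rewrite -exprS -cardF expf_card mulr1.
Qed.

Lemma prim_root_exists : {g : F | (2 * n).-primitive_root g}.
Proof.
have /hasP/sig2W[g _ gP] : has (2 * n).-primitive_root (enum (predC1 (0 : F))).
  apply: has_prim_root; rewrite ?enum_uniq //; first by rewrite muln_gt0.
    by apply/allP => x; rewrite mem_enum unity_rootE => /expf_order->.
  by rewrite -cardE cardC1 cardF.
by exists g.
Qed.

Definition fgen : F := sval prim_root_exists.
Local Notation g := fgen.

Lemma gen_prim : (2 * n).-primitive_root g. Proof. exact: (svalP prim_root_exists). Qed.

Lemma gen_neq0 : g != 0.
Proof.
by apply/eqP=> g0; have /eqP := prim_expr_order gen_prim;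
  rewrite g0 expr0n eqn0Ngt muln_gt0 n_gt0 eq_sym mulr0n oner_eq0.
Qed.

Lemma sum_gen (V : zmodType) (h : F -> V) :
  \sum_(x | x != 0) h x = \sum_(0 <= i < 2 * n) h (g ^+ i).
Proof.
rewrite -big_enum -(big_map (fun i => g ^+ i) xpredT h) /=; apply: perm_big.
have uniq_g : uniq [seq g ^+ i | i <- index_iota 0 (2 * n)].
  rewrite map_inj_in_uniq ?iota_uniq // => i j.
  rewrite !mem_index_iota => /andP[_ lti] /andP[_ ltj] /eqP.
  by rewrite (eq_prim_root_expr gen_prim) !modn_small // => /eqP.
have sub_g : {subset [seq g ^+ i | i <- index_iota 0 (2 * n)] <= enum (predC1 (0 : F))}.
  by move=> x /mapP[i _ ->]; rewrite mem_enum inE expf_neq0 // gen_neq0.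
have [|_ eq_g] := uniq_min_size uniq_g sub_g.
  by rewrite -cardE cardC1 cardF size_map size_iota subn0.
by rewrite perm_sym; exact: uniq_perm uniq_g (enum_uniq _) eq_g.
Qed.

Lemma gen_half : g ^+ n = -1.
Proof.
have /eqP := prim_expr_order gen_prim; rewrite mulnC exprM sqrf_eq1.
case/orP => /eqP // /eqP; rewrite -(prim_order_dvd gen_prim) => /dvdn_leq.
by move: n_gt0; lia.
Qed.

Lemma neq1N1 : (1 : F) != -1.
Proof.
rewrite -gen_half eq_sym -(prim_order_dvd gen_prim).
by apply/negP => /dvdn_leq; move: n_gt0; lia.
Qed.

Lemma eqN11 : (-1 == 1 :> F) = false.
Proof. by rewrite eq_sym (negPf neq1N1). Qed.

(** The quadratic character through Euler's criterion. Integer values make moments of character sums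
    equations over [int]; [qcharE] recovers the residues in [F]. *)
Definition qchar (x : F) : int :=
  if x == 0 then 0 else if x ^+ n == 1 then 1 else -1.
Local Notation chi := qchar.

Lemma expf_half (x : F) : x != 0 -> x ^+ n = 1 \/ x ^+ n = -1.
Proof.
move/expf_order/eqP; rewrite mulnC exprM sqrf_eq1.
by case/orP => /eqP; [left | right].
Qed.

Lemma qcharE x : (chi x)%:~R = x ^+ n.
Proof.
rewrite /chi; case: eqP => [-> | /eqP nzx].
  by rewrite expr0n eqn0Ngt n_gt0.
case: (expf_half nzx) => ->; first by rewrite eqxx.
by rewrite eqN11.
Qed.

Lemma qchar0 : chi 0 = 0. Proof. by rewrite /chi eqxx. Qed.
Lemma qchar1 : chi 1 = 1. Proof. by rewrite /chi oner_eq0 expr1n eqxx. Qed.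

Lemma qcharM x y : chi (x * y) = chi x * chi y.
Proof.
rewrite /chi mulf_eq0; case: eqP => //= [_ | /eqP nzx]; first by rewrite mul0r.
case: eqP => //= [_ | /eqP nzy]; first by rewrite mulr0.
rewrite exprMn; case: (expf_half nzx) (expf_half nzy) => -> [] ->;
  by rewrite ?mulrNN ?mulr1 ?mul1r ?eqxx ?eqN11.
Qed.

Lemma qchar_sqr x : x != 0 -> chi x ^+ 2 = 1.
Proof. by move/negPf=> nzx; rewrite /chi nzx; case: ifP; rewrite ?sqrrN expr1n. Qed.

Lemma qcharX x i : chi (x ^+ i) = chi x ^+ i.
Proof. by elim: i => [|i IH]; rewrite ?qchar1 // !exprS qcharM IH. Qed.

Definition jacobsthal (a : F) : int := \sum_t chi t * chi (t ^+ k + a).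

Lemma natr_card : #|F|%:R = 0 :> F.
Proof. by rewrite -FinRing.Theory.zmodXgE -cardsT expg_cardG ?inE. Qed.

(** Replacing x by g x multiplies the sum by g^e, which forces 0 unless g^e = 1. *)
Lemma sum_expf e : (0 < e)%N ->
  \sum_(x : F) x ^+ e = if (2 * n %| e)%N then -1 else 0.
Proof.
move=> e_gt0; case: ifP => [/dvdnP[c def_e] | ndvd].
  rewrite (bigD1 0) //= expr0n eqn0Ngt e_gt0 add0r.
  rewrite (eq_bigr (fun=> 1)) => [|x nzx]; last first.
    by rewrite def_e mulnC exprM expf_order // expr1n.
  rewrite sumr_const cardC1; apply: (addrI 1); rewrite subrr -natr_card.
  by rewrite -mulrS prednK // cardF.
have: \sum_(x : F) x ^+ e = g ^+ e * \sum_(x : F) x ^+ e.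
  rewrite [LHS](reindex_inj (mulfI gen_neq0)) mulr_sumr.
  by apply: eq_bigr => x _; rewrite exprMn.
move/eqP; rewrite -subr_eq0 -{1}[\sum_(x : F) _]mul1r -mulrBl mulf_eq0 subr_eq0.
by rewrite eq_sym -(prim_order_dvd gen_prim) ndvd => /eqP.
Qed.

(** Expand t^n (t^k + 1)^n into monomials t^(k(M+j)): only exponents divisible by q - 1 = 2kM
    survive summation over t, each contributing -1. *)
Lemma jacobsthal1 :
  (jacobsthal 1)%:~R = - \sum_(0 <= j < n.+1 | (2 * M %| M + j)%N) 'C(n, j)%:R :> F.
Proof.
rewrite rmorph_sum /=.
transitivity (\sum_(0 <= j < n.+1) \sum_(t : F) 'C(n, j)%:R * t ^+ (k * (M + j))).
  rewrite exchange_big; apply: eq_bigr => t _ /=.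
  rewrite rmorphM /= !qcharE addrC exprDn mulr_sumr big_mkord.
  apply: eq_bigr => j _; rewrite expr1n mul1r -exprM mulnDr exprD -mulr_natl -/n.
  by rewrite mulrCA.
rewrite -sumrN [RHS]big_mkcond /=; apply: eq_big_nat => j /andP[_ ltjn].
rewrite -mulr_sumr sum_expf; last by rewrite muln_gt0 k_gt0 addn_gt0 M_gt0.
rewrite (_ : 2 * n = k * (2 * M))%N; last by rewrite /n; lia.
by rewrite dvdn_pmul2l //; case: ifP => _; rewrite ?mulrN1 ?mulr0.
Qed.

Hypothesis k_even : ~~ odd k.

Lemma qchar_expk x : x != 0 -> chi (x ^+ k) = 1.
Proof.
move=> nzx; rewrite qcharX -(odd_double_half k) (negPf k_even) add0n -mul2n.
by rewrite exprM qchar_sqr // expr1n.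
Qed.

Lemma qcharV x : chi x^-1 = chi x.
Proof.
have [-> | nzx] := eqVneq x 0; first by rewrite invr0.
have := qchar_sqr nzx; rewrite -[chi x^-1]mul1r => <-.
by rewrite expr2 -mulrA -qcharM divff // qchar1 mulr1.
Qed.

Lemma qchar_gen : chi g = -1.
Proof. by rewrite /chi (negPf gen_neq0) gen_half eqN11. Qed.

Lemma sum_qchar : \sum_x chi x = 0.
Proof.
have: \sum_x chi x = - \sum_x chi x; last by lia.
rewrite [LHS](reindex_inj (mulfI gen_neq0)) -sumrN; apply: eq_bigr => x _.
by rewrite qcharM qchar_gen mulN1r.
Qed.

(** After a shift the product is chi(a(a+d)). For d nonzero, a(a+d) = a^2 (1 + d/a), and a -> d/a
    turns the sum into that of chi over all elements but 1. *)
Lemma sum_qchar_quad (u v : F) :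
  \sum_a chi (a + u) * chi (a + v) = if u == v then #|F|.-1%:Z else -1.
Proof.
rewrite (reindex_inj (addIr (- u))) /=.
under eq_bigr => a _ do rewrite addrNK -addrA -qcharM.
have -> : (u == v) = (- u + v == 0) by rewrite addrC subr_eq0 eq_sym.
move: (- u + v) => d; rewrite (bigD1 0) //= mul0r qchar0 add0r.
case: eqP => [-> | /eqP nzd].
  rewrite (eq_bigr (fun=> 1)) => [|a nza]; last first.
    by rewrite addr0 qcharM -expr2 qchar_sqr.
  by rewrite sumr_const cardC1 natz.
have -> : \sum_(a | a != 0) chi (a * (a + d)) = \sum_(a | a != 0) chi (1 + a).
  have injh : {in [pred a | a != 0] &, injective (fun a : F => d / a)}.
    by move=> a b _ _ /(mulfI nzd)/invr_inj.
  rewrite [RHS](reindex (fun a : F => d / a)) /=; last first.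
    by exists (fun a => d / a) => a _; rewrite invf_div mulrCA divff ?mulr1.
  rewrite [RHS](eq_bigl (fun a => a != 0)) => [|a]; last first.
    by rewrite mulf_eq0 invr_eq0 (negPf nzd).
  apply: eq_bigr => a nza.
  have -> : a * (a + d) = a ^+ 2 * (1 + d / a) by field.
  by rewrite qcharM qcharX qchar_sqr // mul1r.
have := sum_qchar; rewrite (reindex_inj (addrI 1)) (bigD1 0) //= addr0 qchar1.
by move/eqP; rewrite addrC addr_eq0 => /eqP E; exact: E.
Qed.

(** Write s = t w with w^k = 1. Then chi(w) = 1, because w^n = (w^k)^M, and there are k such w,
    because k divides q - 1. *)
Lemma sum_exp_eq (t : F) : t != 0 ->
  \sum_s chi t * chi s * (s ^+ k == t ^+ k)%:R = k%:Z.
Proof.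
move=> nzt; rewrite (bigD1 0) //= qchar0 mulr0 mul0r add0r.
transitivity (\sum_(w : F | w != 0) ((w ^+ k == 1)%:R : int)); last first.
  have <- : \sum_(0 <= i < k * (2 * M)) ((2 * M %| i)%:R : int) = k%:Z.
    rewrite sum_periodic => [|i]; last by rewrite dvdn_addr.
    rewrite big_ltn ?muln_gt0 // dvdn0 big_nat big1 ?addr0 ?natz // => i.
    case/andP=> i_gt0 lti; rewrite (_ : _ %| _ = false)%N //.
    by apply/negP => /dvdn_leq; lia.
  rewrite sum_gen (_ : 2 * n = k * (2 * M))%N; last by rewrite /n; lia.
  apply: eq_bigr => i _; rewrite -exprM -(prim_order_dvd gen_prim) /n.
  by rewrite mulnCA mulnC [(2 * M * k)%N]mulnC [(i * k)%N]mulnC dvdn_pmul2l.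
rewrite [LHS](reindex_inj (mulfI nzt)) /=.
rewrite (eq_bigl (fun w => w != 0)) => [|w]; last first.
  by rewrite mulf_eq0 (negPf nzt).
apply: eq_bigr => w nzw; rewrite exprMn -[X in _ == X]mulr1.
rewrite (inj_eq (mulfI (expf_neq0 k nzt))) qcharM mulrA -expr2 qchar_sqr // mul1r.
case: eqP => [wk1 | _]; last by rewrite mulr0.
by rewrite mulr1 /chi (negPf nzw) /n exprM wk1 expr1n eqxx.
Qed.

Lemma jacobsthal0 : jacobsthal 0 = 0.
Proof.
rewrite -[RHS]sum_qchar; apply: eq_bigr => t _; rewrite addr0.
have [-> | nzt] := eqVneq t 0; first by rewrite qchar0 mul0r.
by rewrite qchar_expk // mulr1.
Qed.

(** Substitute t -> b t; k being even, chi(b^k) = 1. Up to sign, J(a) thus depends only on a modulo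
    k-th powers. *)
Lemma jacobsthalM a b : b != 0 -> jacobsthal (a * b ^+ k) = chi b * jacobsthal a.
Proof.
move=> nzb; rewrite /jacobsthal (reindex_inj (mulfI nzb)) /= mulr_sumr.
apply: eq_bigr => t _.
have -> : (b * t) ^+ k + a * b ^+ k = b ^+ k * (t ^+ k + a).
  by rewrite exprMn mulrDr [b ^+ k * a]mulrC.
by rewrite !qcharM qchar_expk // mul1r mulrA.
Qed.

(** Substitute t -> 1/t. *)
Lemma jacobsthalV a : a != 0 -> jacobsthal a = chi a * jacobsthal a^-1.
Proof.
move=> nza; rewrite /jacobsthal (bigD1 0) //= qchar0 mul0r add0r.
rewrite [in RHS](bigD1 0) //= qchar0 mul0r add0r mulr_sumr.
rewrite [LHS](reindex_inj (@invr_inj F)) /=.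
rewrite (eq_bigl (fun t => t != 0)) => [|t]; last by rewrite invr_eq0.
apply: eq_bigr => t nzt.
have -> : t^-1 ^+ k + a = a * (t ^+ k + a^-1) * (t^-1) ^+ k.
  by rewrite exprVn; field; rewrite nza expf_neq0.
by rewrite !qcharM qchar_expk ?invr_eq0 // qcharV; ring.
Qed.

(** Expanding the square and summing over a first leaves q [s^k = t^k] - 1; the -1 dies against the
    sum of chi, and [sum_exp_eq] counts the rest. *)
Lemma jacobsthal_moment : \sum_a jacobsthal a ^+ 2 = (#|F| * (2 * n) * k)%N%:Z.
Proof.
transitivity (\sum_t \sum_s chi t * chi s *
   \sum_a chi (a + t ^+ k) * chi (a + s ^+ k)).
  under eq_bigr => a _ do rewrite expr2 /jacobsthal mulr_suml.
  rewrite exchange_big; apply: eq_bigr => t _ /=.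
  under eq_bigr => a _ do rewrite mulr_sumr.
  rewrite exchange_big; apply: eq_bigr => s _ /=.
  rewrite mulr_sumr; apply: eq_bigr => a _.
  by rewrite ![_ + a]addrC; ring.
transitivity (\sum_(t : F | t != 0) (#|F| * k)%N%:Z); last first.
  by rewrite sumr_const cardC1 cardF /= -natz -mulrnA natz; congr Posz; rewrite -/n; ring.
transitivity (\sum_t chi t * (- \sum_s chi s) +
   \sum_(t | t != 0) #|F|%:Z * \sum_s chi t * chi s * (s ^+ k == t ^+ k)%:R).
  rewrite [X in _ = _ + X](_ : _ = \sum_t #|F|%:Z *
      \sum_s chi t * chi s * (s ^+ k == t ^+ k)%:R); last first.
    rewrite [RHS](bigD1 0) //= [X in _ * X]big1 ?mulr0 ?add0r // => s _.
    by rewrite qchar0 !mul0r.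
  rewrite -big_split; apply: eq_bigr => t _ /=.
  rewrite -sumrN mulr_sumr mulr_sumr -big_split; apply: eq_bigr => s _ /=.
  rewrite sum_qchar_quad eq_sym; case: eqP => _; rewrite ?mulr0 ?mulr1 ?addr0 ?mulrN1 //.
    by rewrite cardF /= -/n; lia.
  by ring.
rewrite sum_qchar oppr0 big1 ?add0r => [|t _]; last by rewrite mulr0.
by apply: eq_bigr => t nzt; rewrite sum_exp_eq // PoszM.
Qed.

(** J(g^i)^2 has period k in i, so the 2kM nonzero arguments run through 2M equal periods. *)
Lemma jacobsthal_moment_gen : \sum_(0 <= i < k) jacobsthal (g ^+ i) ^+ 2 = (k ^ 2 * #|F|)%N%:Z.
Proof.
have := jacobsthal_moment; rewrite (bigD1 0) //= jacobsthal0 expr0n add0r sum_gen.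
rewrite (_ : 2 * n = 2 * M * k)%N; last by rewrite /n; lia.
rewrite sum_periodic => [|i]; last first.
  by rewrite addnC exprD jacobsthalM ?gen_neq0 // qchar_gen mulN1r sqrrN.
rewrite -mulr_natr natz => E; apply: (@mulIf _ (2 * M)%N%:Z).
  by rewrite eqz_nat -lt0n muln_gt0.
by rewrite E -PoszM; congr Posz; rewrite /n; lia.
Qed.

End FiniteFieldCharacterSums.

(** * Quadratic forms from the second moments for k = 2 and k = 4 *)

Lemma int_parity (x : int) : exists c : int, x = 2 * c \/ x = 2 * c + 1.
Proof.
exists (x %/ 2)%Z; have := divz_eq x 2; have := modz_ge0 x (isT : 2 != 0 :> int).
have := ltz_mod x (isT : 2 != 0 :> int); lia.
Qed.

(** For k = 2 the moment reads J(1)^2 + J(g)^2 = 4q, and only j = M survives in [jacobsthal1]. J(1)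
    is even since its summand takes equal values at t and -t. The parity of A is recorded to
    identify it later. *)
Lemma finfield_sum_two_squares (F : finFieldType) (M : nat) :
    (0 < M)%N -> #|F| = (4 * M).+1 ->
  exists A B : int, [/\ #|F|%:Z = A ^+ 2 + B ^+ 2, ~~ (2 %| A)%Z &
    (2 * A)%:~R = - 'C(2 * M, M)%:R :> F].
Proof.
move=> M_gt0 cardF'.
have cardF : #|F| = (2 * (2 * M)).+1 by rewrite cardF'; congr _.+1; lia.
have k_even : ~~ odd 2 by []. have k_gt0 : (0 < 2)%N by [].
pose g := fgen k_gt0 M_gt0 cardF; pose chi := @qchar F 2 M.
pose h i := chi (g ^+ i) * chi ((g ^+ i) ^+ 2 + 1).
pose A := \sum_(0 <= i < 2 * M) h i.
have g2M : g ^+ (2 * M) = -1 := gen_half k_gt0 M_gt0 cardF.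
have chiM x y : chi (x * y) = chi x * chi y := qcharM k_gt0 M_gt0 cardF x y.
have chi2 (x : F) : x != 0 -> chi x ^+ 2 = 1 by apply: qchar_sqr.
have nzg i : g ^+ i != 0 by rewrite expf_neq0 // gen_neq0.
have chiN1 : chi (-1) = 1 by rewrite -g2M mulnC exprM expr2 chiM -expr2 chi2.
have JA : jacobsthal 2 M (1 : F) = 2 * A.
  rewrite /jacobsthal (bigD1 0) //= qchar0 mul0r add0r (sum_gen k_gt0 M_gt0 cardF).
  rewrite sum_periodic => [|i]; last first.
    rewrite addnC exprD -/g -/chi g2M mulrN1 sqrrN; congr (_ * _).
    by rewrite -mulN1r chiM chiN1 mul1r.
  by rewrite mulr2n -/A -/chi -/g; rewrite (_ : 2 = 1 + 1) // mulrDl mul1r.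
have hE i : (i < 2 * M)%N -> i != M -> h i ^+ 2 = 1.
  move=> lti neqi; rewrite exprMn !chi2 ?mulr1 //; apply: contraNneq neqi.
  move/eqP; rewrite addr_eq0 -g2M -exprM.
  rewrite (eq_prim_root_expr (gen_prim k_gt0 M_gt0 cardF)) => /eqP.
  have lt2i : (i * 2 < 2 * (2 * M))%N by lia.
  have lt2M : (2 * M < 2 * (2 * M))%N by lia.
  by rewrite !modn_small // => E; apply/eqP; lia.
have hM : h M = 0 by rewrite /h -exprM mulnC g2M addNr /chi qchar0 mulr0.
(* The term at i = M is the only zero, which leaves a sum of 2M - 1 signs. *)
have odd_A : ~~ (2 %| A)%Z.
  have ltM : (M < 2 * M)%N by lia.
  rewrite /A big_mkord (bigD1 (Ordinal ltM)) //= hM add0r.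
  have -> : \sum_(i < 2 * M | i != Ordinal ltM) h i =
      \sum_(i < 2 * M | i != Ordinal ltM) (1 - 2 * (h i == -1)%:R).
    apply: eq_bigr => i neqi; have /eqP := hE i (ltn_ord i) neqi.
    by rewrite sqrf_eq1 => /orP[] /eqP->.
  rewrite sumrB -mulr_sumr sumr_const cardC1 card_ord natz.
  by move: (\sum_(i < _ | _) _) => c; lia.
have := jacobsthal_moment_gen k_gt0 M_gt0 cardF k_even.
rewrite big_nat_recl // big_nat1 expr0 JA.
move: (jacobsthal _ _ _) => Y E; have [B [EB | EB]] := int_parity Y; last by nia.
exists A, B; split=> //; first by rewrite EB in E; lia.
rewrite -JA (jacobsthal1 k_gt0 M_gt0 cardF); congr (- _).
rewrite big_mkcond (bigD1_seq M) ?iota_uniq ?mem_index_iota //=; last by lia.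
rewrite addnn -mul2n dvdnn big1_seq ?addr0 // => i /andP[neqi].
rewrite mem_index_iota => /andP[_ lti]; case: ifP => // /dvdnP[c Ec].
by case/eqP: neqi; case: c Ec => [|[|c]] Ec; nia.
Qed.

(** For k = 4 two relations among the J(g^i) reduce the moment to J(1)^2 + 2 J(g)^2 = 16q. In
    [jacobsthal1] the indices M and 3M survive, with equal binomials. *)
Lemma finfield_sqr_plus_two_sqr (F : finFieldType) (M : nat) :
    (0 < M)%N -> #|F| = (8 * M).+1 ->
  exists A B : int, #|F|%:Z = A ^+ 2 + 2 * B ^+ 2 /\
    (2 * A)%:~R = - 'C(4 * M, M)%:R :> F.
Proof.
move=> M_gt0 cardF'.
have cardF : #|F| = (2 * (4 * M)).+1 by rewrite cardF'; congr _.+1; lia.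
have k_even : ~~ odd 4 by []. have k_gt0 : (0 < 4)%N by [].
pose g := fgen k_gt0 M_gt0 cardF; pose J := @jacobsthal F 4 M.
have nzg : g != 0 by apply: gen_neq0.
have JM a : J (a * g ^+ 4) = - J a.
  by rewrite [LHS](jacobsthalM k_gt0 M_gt0 cardF k_even) // qchar_gen mulN1r.
have JV i : J (g ^+ i) = (-1) ^+ i * J (g ^- i).
  rewrite [LHS](jacobsthalV k_gt0 M_gt0 cardF k_even) ?expf_neq0 //.
  by rewrite (qcharX k_gt0 M_gt0 cardF) qchar_gen.
(* Shifting by g^4 changes the sign of J while inversion keeps it at even powers, so J(g^2) = -
   J(g^2). *)
have J2 : J (g ^+ 2) = 0.
  have E : J (g ^+ 2) = - J (g ^- 2) by rewrite -JM; congr J; field.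
  move: E; rewrite JV sqrrN expr1n mul1r; move: (J _) => z; lia.
have J3 : J (g ^+ 3) = J (g ^+ 1).
  by rewrite JV expr1 mulN1r -JM; congr J; field.
have := jacobsthal_moment_gen k_gt0 M_gt0 cardF k_even.
rewrite !big_nat_recl // big_nil expr0 -/J -/g J2 J3.
have JE := jacobsthal1 k_gt0 M_gt0 cardF; move: JE; rewrite -/J.
move: (J 1) (J (g ^+ 1)) => X Y JE E.
have {E} E : X ^+ 2 + 2 * Y ^+ 2 = 16 * #|F|%:Z by lia.
move: (#|F|%:Z) E => q E.
(* Repeated parity arguments show that 4 divides both X and Y. *)
have [a [Ea | Ea]] := int_parity X; rewrite {}Ea in E JE; last by nia.
have [b [Eb | Eb]] := int_parity Y; rewrite {}Eb in E; last by nia.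
have [A [EA | EA]] := int_parity a; rewrite {}EA in E JE; last by nia.
have [B [EB | EB]] := int_parity b; rewrite {}EB in E; last by nia.
exists A, B; split; first by lia.
have nz2 : 2 != 0 :> F.
  by have := neq1N1 k_gt0 M_gt0 cardF; rewrite -subr_eq0 opprK.
apply: (mulfI nz2); rewrite -[X in X * _ = _]/(2%:~R) -intrM JE.
rewrite mulrN; congr (- _).
rewrite big_mkcond (bigD1_seq M) ?iota_uniq ?mem_index_iota //=; last by lia.
rewrite addnn -mul2n dvdnn mulr_natl mulr2n; congr (_ + _).
rewrite big_mkcond (bigD1_seq (3 * M)%N) ?iota_uniq ?mem_index_iota //=; last by lia.
have -> : (3 * M != M)%N by lia.
have -> : (M + 3 * M = 2 * (2 * M))%N by lia.
rewrite dvdn_mull // (_ : 'C(4 * M, 3 * M) = 'C(4 * M, M)); last first.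
  by rewrite -[RHS]bin_sub; [congr 'C(_, _); lia | lia].
rewrite big1_seq ?addr0 // => i /andP[neq3].
rewrite mem_index_iota => /andP[_ lti]; case: ifP => // neqi.
case: ifP => // /dvdnP[c Ec].
move/eqP: neq3 => neq3; move/eqP: neqi => neqi.
by case: c Ec => [|[|[|c]]] Ec; nia.
Qed.

(** * Representations of p by quadratic forms *)

Lemma intr_eq0_pchar (F : fieldType) (p : nat) (z : int) : p \in [pchar F] ->
  (z%:~R == 0 :> F) = (p%:Z %| z)%Z.
Proof.
move=> pcharF; rewrite dvdzE /= (dvdn_pcharf pcharF).
by case: z => m //=; rewrite NegzE rmorphN /= oppr_eq0.
Qed.

Lemma Euclid_dvdzM (p : nat) (a b : int) : prime p ->
  (p%:Z %| a * b)%Z = (p%:Z %| a)%Z || (p%:Z %| b)%Z.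
Proof. by move=> p_pr; rewrite !dvdzE abszM Euclid_dvdM. Qed.

Lemma int_sqr_ge1 (c : int) : c != 0 -> 1 <= c ^+ 2.
Proof. by move=> nzc; rewrite -gtz0_ge1 exprn_even_gt0. Qed.

(** Used on Brahmagupta's identity: a nonzero multiple of N already exhausts the right-hand side. *)
Lemma int_sqr_sum (s c N d : int) : 0 < d -> 0 < N -> c != 0 ->
  s ^+ 2 + d * (c * N) ^+ 2 = N ^+ 2 -> d = 1 /\ s = 0.
Proof.
move=> d_gt0 N_gt0 /int_sqr_ge1 c_ge1 E; have s_ge0 := sqr_ge0 s.
have N2_gt0 : 0 < N ^+ 2 by rewrite exprn_gt0.
have E1 : s ^+ 2 = N ^+ 2 * (1 - d * c ^+ 2).
  by rewrite -{1}[s ^+ 2](addrK (d * (c * N) ^+ 2)) E; ring.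
have : 0 <= 1 - d * c ^+ 2 by rewrite -(pmulr_rge0 _ N2_gt0) -E1.
have le_dc : d <= d * c ^+ 2 by rewrite ler_peMr // ltW.
move=> h; have d1 : d = 1 by lia.
split=> //; apply/eqP; rewrite -sqrf_eq0 eq_le s_ge0 andbT E1 pmulr_rle0 //.
lia.
Qed.

(** p divides (Ay - Bx)(Ay + Bx); up to the sign of y let Ay - Bx = cp. By (Ax + By)^2 + (Ay - Bx)^2
    = p^2, either c = 0, whence A^2 = x^2, or Ax + By = 0, which is impossible as A, x are odd and y
    is even. *)
Lemma sum_two_squares_uniq (p : nat) (A B x y : int) : prime p ->
    p%:Z = A ^+ 2 + B ^+ 2 -> p%:Z = x ^+ 2 + y ^+ 2 ->
    ~~ (2 %| A)%Z -> ~~ (2 %| x)%Z -> (2 %| y)%Z ->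
  A ^+ 2 = x ^+ 2.
Proof.
move=> p_pr EA Ex oddA oddx even_y; have p_gt0 := prime_gt0 p_pr.
have aux Y : p%:Z = x ^+ 2 + Y ^+ 2 -> (2 %| Y)%Z ->
    (p%:Z %| A * Y - B * x)%Z -> A ^+ 2 = x ^+ 2.
  move=> {}Ex /dvdzP[d Ed] /dvdzP[c Ec].
  have E1 : (A * x + B * Y) ^+ 2 + (A * Y - B * x) ^+ 2 = p%:Z ^+ 2.
    by rewrite [p%:Z ^+ 2]expr2 {1}EA Ex; ring.
  have [c0 | nzc] := eqVneq c 0.
    have E2 : A ^+ 2 * p%:Z = x ^+ 2 * p%:Z.
      have E3 : A * Y = B * x by apply/eqP; rewrite -subr_eq0 Ec c0 mul0r.
      transitivity (A ^+ 2 * x ^+ 2 + (A * Y) ^+ 2); first by rewrite Ex; ring.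
      by rewrite E3 EA; ring.
    by apply: (mulIf _ E2); rewrite eqz_nat -lt0n.
  have AxBY0 : A * x + B * Y = 0.
    have := @int_sqr_sum (A * x + B * Y) c p%:Z 1; rewrite mul1r -Ec.
    by case=> //; lia.
  have [a [Ea | Ea]] := int_parity A; first by case/negP: oddA; rewrite Ea dvdz_mulr.
  have [b [Eb | Eb]] := int_parity x; first by case/negP: oddx; rewrite Eb dvdz_mulr.
  by move: AxBY0; rewrite Ea Eb Ed; clear; lia.
have : (p%:Z %| (A * y - B * x) * (A * y + B * x))%Z.
  apply/dvdzP; exists (y ^+ 2 - B ^+ 2).
  transitivity (y ^+ 2 * p%:Z - B ^+ 2 * p%:Z); last by ring.
  by rewrite {1}EA Ex; ring.
rewrite Euclid_dvdzM // => /orP[]; first exact: aux.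
move=> dvd; apply: (aux (- y)); rewrite ?sqrrN //.
  by rewrite -mulN1r dvdz_mull.
by rewrite mulrN -opprD rpredN.
Qed.

(** The coefficient 2 in Brahmagupta's identity forces Av = Bu by [int_sqr_sum]. N need not be
    prime, as N = p^2 occurs below. *)
Lemma sqr_plus_two_sqr_uniq (N A B u v : int) :
    N = A ^+ 2 + 2 * B ^+ 2 -> N = u ^+ 2 + 2 * v ^+ 2 -> 0 < N ->
    (N %| A * v - B * u)%Z ->
  A ^+ 2 = u ^+ 2.
Proof.
move=> EA Eu N_gt0 /dvdzP[c Ec].
have E1 : (A * u + 2 * B * v) ^+ 2 + 2 * (A * v - B * u) ^+ 2 = N ^+ 2.
  by rewrite [N ^+ 2]expr2 {1}EA Eu; ring.
have c0 : c = 0.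
  apply/eqP/negPn/negP => nzc.
  by have [] := @int_sqr_sum (A * u + 2 * B * v) c N 2; rewrite -?Ec.
have E2 : A ^+ 2 * N = u ^+ 2 * N.
  have E3 : A * v = B * u by apply/eqP; rewrite -subr_eq0 Ec c0 mul0r.
  transitivity (A ^+ 2 * u ^+ 2 + 2 * (A * v) ^+ 2); first by rewrite Eu; ring.
  by rewrite E3 EA; ring.
by apply: (mulIf _ E2); rewrite gt_eqF.
Qed.

Lemma coef_exp_1DX (R : comNzRingType) (N i : nat) :
  ((1 + 'X) ^+ N : {poly R})`_i = 'C(N, i)%:R.
Proof.
have -> : (1 + 'X) ^+ N = \poly_(j < N.+1) 'C(N, j)%:R :> {poly R}.
  rewrite exprDn poly_def; apply: eq_bigr => j _.
  by rewrite expr1n mul1r scaler_nat.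
by rewrite coef_poly ltnS; case: leqP => // ltNi; rewrite bin_small.
Qed.

(** Lucas' theorem for two digits: compare coefficients in (1+X)^(np+n) = (1+X^p)^n (1+X)^n. The
    repeated digit n fits (p^2-1)/2 with n = (p-1)/2. *)
Lemma bin_Lucas (R : comNzRingType) (p n m r : nat) :
    p \in [pchar R] -> (n < p)%N -> (r < p)%N ->
  'C(n * p + n, m * p + r)%:R = 'C(n, m)%:R * 'C(n, r)%:R :> R.
Proof.
move=> pcharR ltnp ltrp.
have pcharX : p \in [pchar {poly R}] by rewrite pchar_poly.
rewrite -coef_exp_1DX exprD mulnC exprM.
have -> : (1 + 'X) ^+ p = 1 + 'X^p :> {poly R}.
  rewrite -!(pFrobenius_autE pcharX) pFrobenius_autD_comm ?pFrobenius_aut1 //.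
  exact: mulrC.
rewrite exprDn mulr_suml coef_sum.
transitivity (\sum_(i < n.+1) if (i == m :> nat) then 'C(n, m)%:R * 'C(n, r)%:R else 0 : R).
  apply: eq_bigr => i _.
  rewrite expr1n mul1r -exprM -mulr_natl -mulrA -polyC_natr coefCM coefXnM coef_exp_1DX.
  case: (ltngtP i m) => [ltim | ltmi | <-].
  - have := leq_mul ltim (leqnn p); rewrite mulSn => le_mp.
    rewrite ifF; last by lia.
    by rewrite [in X in _ * X]bin_small ?mulr0 //; lia.
  - have := leq_mul ltmi (leqnn p); rewrite mulSn => le_mp.
    by rewrite ifT ?mulr0 //; lia.
  - by rewrite [(p * i)%N]mulnC ltnNge leq_addr addKn.
have [lemn | ltnm] := ltnP m n.+1.
  rewrite (bigD1 (Ordinal lemn)) //= eqxx big1 ?addr0 // => i neqi.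
  by rewrite ifF //; apply: contraNF neqi => /eqP Ei; apply/eqP/val_inj.
rewrite (bin_small ltnm) mul0r big1 // => i _.
by case: ifP.
Qed.

Lemma pchar_natr_neq0 (F : fieldType) (p j : nat) : p \in [pchar F] ->
  (0 < j < p)%N -> j%:R != 0 :> F.
Proof.
move=> pcharF /andP[j_gt0 ltjp]; rewrite -(dvdn_pcharf pcharF).
by apply/negP => /dvdn_leq; lia.
Qed.

Lemma pchar_fact_neq0 (F : fieldType) (p j : nat) : p \in [pchar F] ->
  (j < p)%N -> j`!%:R != 0 :> F.
Proof.
move=> pcharF; elim: j => [|j IH] ltjp; first by rewrite oner_eq0.
by rewrite factS natrM mulf_neq0 ?IH ?(pchar_natr_neq0 pcharF) //; lia.
Qed.

Lemma pchar_bin_neq0 (F : fieldType) (p n m : nat) : p \in [pchar F] ->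
  (m <= n < p)%N -> 'C(n, m)%:R != 0 :> F.
Proof.
move=> pcharF /andP[lemn ltnp]; have := pchar_fact_neq0 pcharF ltnp.
by rewrite -(bin_fact lemn) natrM mulf_eq0 negb_or => /andP[].
Qed.

(** * Squares of binomial coefficients modulo p in terms of quadratic forms *)

Section PrimeField.
Variables (p : nat).
Hypothesis p_prime : prime p.

(** The square of Gauss's congruence C(2M, M) = +-2x; squaring removes the choice of sign of x. *)
Lemma sum_two_squares_bin (M : nat) (x y : int) : p = (4 * M).+1 ->
    p%:Z = x ^+ 2 + y ^+ 2 -> ~~ (2 %| x)%Z -> (2 %| y)%Z ->
  ('C(2 * M, M)%:R : 'F_p) ^+ 2 = 4 * x%:~R ^+ 2.
Proof.
move=> def_p Ex oddx eveny; have M_gt0 : (0 < M)%N by case: M def_p p_prime => // ->.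
have cardF : #|'F_p| = (4 * M).+1 by rewrite card_Fp.
have [A [B [EA oddA EC]]] := finfield_sum_two_squares M_gt0 cardF.
rewrite cardF -def_p in EA.
have EAx := sum_two_squares_uniq p_prime EA Ex oddA oddx eveny.
by rewrite -[LHS]sqrrN -EC -[x%:~R ^+ 2]rmorphXn -EAx /= rmorphXn rmorphM /=; ring.
Qed.

Lemma sqr_plus_two_sqr_bin1 (M : nat) (x y : int) : p = (8 * M).+1 ->
    p%:Z = x ^+ 2 + 2 * y ^+ 2 ->
  ('C(4 * M, M)%:R : 'F_p) ^+ 2 = 4 * x%:~R ^+ 2.
Proof.
move=> def_p Ex; have M_gt0 : (0 < M)%N by case: M def_p p_prime => // ->.
have cardF : #|'F_p| = (8 * M).+1 by rewrite card_Fp.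
have [A [B [EA EC]]] := finfield_sqr_plus_two_sqr M_gt0 cardF.
rewrite cardF -def_p in EA.
have p_gt0 : 0 < p%:Z by have := prime_gt0 p_prime; lia.
have EAx : A ^+ 2 = x ^+ 2.
  have : (p%:Z %| (A * y - B * x) * (A * y + B * x))%Z.
    apply/dvdzP; exists (y ^+ 2 - B ^+ 2).
    transitivity (y ^+ 2 * p%:Z - B ^+ 2 * p%:Z); last by ring.
    by rewrite {1}EA Ex; ring.
  rewrite Euclid_dvdzM // => /orP[dvd | dvd].
    exact: sqr_plus_two_sqr_uniq EA Ex p_gt0 dvd.
  apply: (@sqr_plus_two_sqr_uniq p%:Z A (- B) x y) => //; first by rewrite sqrrN.
  by rewrite mulNr opprK.
by rewrite -[LHS]sqrrN -EC -[x%:~R ^+ 2]rmorphXn -EAx /= rmorphXn rmorphM /=; ring.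
Qed.

(* The quartic sums live over F_{p^2}, where p^2 = A^2 + 2 B^2 forces
   A = +- (x^2 - 2 y^2), hence 'C(4 M + 1, M)^2 = +- 4 x^2; the sign is + because -1
   is not a square modulo p. *)
Lemma sqr_plus_two_sqr_bin3 (M : nat) (x y : int) : p = (8 * M + 3)%N ->
    p%:Z = x ^+ 2 + 2 * y ^+ 2 ->
  ('C(4 * M + 1, M)%:R : 'F_p) ^+ 2 = 4 * x%:~R ^+ 2.
Proof.
(* [K] is (p^2 - 1)/8. In base p its digits are M and 3M+1, and those of 4K are n and n. *)
move=> def_p; set n := (4 * M + 1)%N; pose K := (8 * M ^ 2 + 6 * M + 1)%N.
have lt_np : (n < p)%N by rewrite /n; lia.
have lt_rp : (3 * M + 1 < p)%N by lia.
have le_Mn : (M <= n)%N by rewrite /n; lia.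
have le_rn : (3 * M + 1 <= n)%N by rewrite /n; lia.
have def_M : (n - (3 * M + 1) = M)%N by rewrite /n; lia.
have def_4K : (4 * K = n * p + n)%N by rewrite /K /n def_p; lia.
have def_K : (K = M * p + (3 * M + 1))%N by rewrite /K def_p; lia.
have def_2n : ((2 * n).+1 = p)%N by rewrite def_p /n; lia.
have K_gt0 : (0 < K)%N by rewrite /K; lia.
have def_p2 : (p ^ 2 = (8 * K).+1)%N by rewrite def_p /K; lia.
have p_gt2 : (2 < p)%N by lia.
have p_odd : exists m : int, p%:Z = 4 * m + 3 by exists (2 * M)%N%:Z; lia.
have pcharp := pchar_Fp p_prime.
set C := 'C(n, M) => Ex.
have nzC : C%:R != 0 :> 'F_p by apply: pchar_bin_neq0 pcharp _; rewrite le_Mn.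
have ndvd2 : ~~ (p%:Z %| 2)%Z.
  by rewrite dvdzE /=; apply: contraTN p_gt2 => /dvdn_leq; rewrite -leqNgt; apply.
clear def_p.
have ndvd z : z != 0 -> z ^+ 2 <= p%:Z -> ~~ (p%:Z %| z)%Z.
  move=> nzz; apply: contraTN => /dvdzP[c Ec].
  have /int_sqr_ge1 c2_ge1 : c != 0 by apply: contraNneq nzz => c0; rewrite Ec c0 mul0r.
  have p2_ge0 : 0 <= p%:Z ^+ 2 by apply: sqr_ge0.
  have le_p2 : p%:Z ^+ 2 <= z ^+ 2 by rewrite Ec exprMn ler_peMl.
  rewrite -ltNge; apply: lt_le_trans le_p2.
  by rewrite expr2 ltr_pMr ltz_nat; lia.
have [x2_ge0 y2_ge0] : 0 <= x ^+ 2 /\ 0 <= y ^+ 2 by rewrite !sqr_ge0.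
have ndvdx : ~~ (p%:Z %| x)%Z.
  apply: ndvd; last by rewrite Ex; move: y2_ge0; clear; lia.
  apply/eqP => x0; have [m Em] := p_odd.
  by move: Ex; rewrite Em x0; clear; lia.
have ndvdy : ~~ (p%:Z %| y)%Z.
  apply: ndvd; last by rewrite Ex; move: x2_ge0 y2_ge0; clear; lia.
  apply/eqP => y0; have [m Em] := p_odd; have [d [Ed | Ed]] := int_parity x;
    by move: Ex; rewrite Em y0 Ed; clear; lia.
have [F pcharF cardF] := pPrimePowerField p_prime (isT : (0 < 2)%N).
have cardFK : #|F| = (8 * K).+1 by rewrite cardF.
have [A [B [EA EC]]] := finfield_sqr_plus_two_sqr K_gt0 cardFK.
rewrite cardF in EA.
(* By Lucas, C(4K, K) = C(n, M) C(n, 3M+1), and the two factors agree by symmetry. *)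
have dvdAC : (p%:Z %| 2 * A + C%:Z ^+ 2)%Z.
  rewrite -(intr_eq0_pchar _ pcharF) rmorphD /= EC.
  rewrite def_4K [K in 'C(_, K)]def_K (bin_Lucas _ pcharF) //.
  rewrite -['C(n, 3 * M + 1)]bin_sub // def_M.
  by rewrite rmorphXn /= expr2 addNr.
have EA2 : (2 * A)%:~R = - (C%:R ^+ 2) :> 'F_p.
  move: dvdAC; rewrite -(intr_eq0_pchar _ pcharp) rmorphD rmorphXn /= addr_eq0.
  by move/eqP.
have ndvdA : ~~ (p%:Z %| A)%Z.
  apply/negP => dvdA; move: EA2; rewrite rmorphM /=.
  have /eqP-> : A%:~R == 0 :> 'F_p by rewrite (intr_eq0_pchar _ pcharp).
  by rewrite mulr0 => /esym/eqP; rewrite oppr_eq0 expf_eq0 (negPf nzC).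
(* The coordinates of (x + y sqrt(-2))^2, an element of norm p^2. *)
pose u := x ^+ 2 - 2 * y ^+ 2; pose v := 2 * x * y.
have Eu : (p ^ 2)%N%:Z = u ^+ 2 + 2 * v ^+ 2.
  by rewrite -mulnn PoszM /u /v Ex; ring.
have ndvdv : ~~ (p%:Z %| v)%Z.
  by rewrite /v !Euclid_dvdzM // !negb_or ndvdx ndvdy ndvd2.
have N_gt0 : 0 < (p ^ 2)%N%:Z by rewrite def_p2.
have EAu : A ^+ 2 = u ^+ 2.
  (* p^2 divides the product; p cannot divide both factors, whose sum is 2Av, so p^2 divides one of
     them. *)
  have dvdN : ((p ^ 2)%N%:Z %| (A * v - B * u) * (A * v + B * u))%Z.
    apply/dvdzP; exists (v ^+ 2 - B ^+ 2).
    transitivity (v ^+ 2 * (p ^ 2)%N%:Z - B ^+ 2 * (p ^ 2)%N%:Z); last by ring.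
    by rewrite {1}EA Eu; ring.
  have cop z : ~~ (p%:Z %| z)%Z -> coprimez (p ^ 2)%N%:Z z.
    by move=> ndvdz; rewrite coprimezE /= coprime_pexpl // prime_coprime.
  have [dvd1 | ndvd1] := boolP (p%:Z %| A * v - B * u)%Z.
    have ndvd3 : ~~ (p%:Z %| A * v + B * u)%Z.
      apply/negP => dvd2; have := rpredD dvd1 dvd2.
      rewrite (_ : A * v - B * u + (A * v + B * u) = 2 * (A * v)); last by ring.
      rewrite 2?Euclid_dvdzM // (negPf ndvdA) (negPf ndvdv) !orbF.
      by rewrite (negPf ndvd2).
    rewrite Gauss_dvdzl ?cop // in dvdN.
    exact: sqr_plus_two_sqr_uniq EA Eu N_gt0 dvdN.
  rewrite Gauss_dvdzr ?cop // in dvdN.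
  apply: (@sqr_plus_two_sqr_uniq (p ^ 2)%N%:Z A (- B) u v) => //.
    by rewrite sqrrN.
  by rewrite mulNr opprK.
have Eu2 : u%:~R = 2 * x%:~R ^+ 2 :> 'F_p.
  have -> : u = 2 * x ^+ 2 - p%:Z by rewrite Ex /u; ring.
  rewrite rmorphB rmorphM rmorphXn /=.
  by rewrite [p%:~R](pcharf0 pcharp) subr0.
have E4 : (C%:R ^+ 2) ^+ 2 = (4 * x%:~R ^+ 2) ^+ 2 :> 'F_p.
  rewrite -[LHS]sqrrN -EA2 rmorphM /= exprMn -[A%:~R ^+ 2]rmorphXn /= EAu rmorphXn /= Eu2.
  by ring.
have {E4} /orP[/eqP // | /eqP E4] : (C%:R ^+ 2 == 4 * x%:~R ^+ 2 :> 'F_p) ||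
    (C%:R ^+ 2 == - (4 * x%:~R ^+ 2) :> 'F_p) by rewrite -eqf_sqr E4.
have nzx : 2 * x%:~R != 0 :> 'F_p.
  apply/eqP => x0; move: E4; rewrite (_ : 4 * _ = (2 * x%:~R) ^+ 2); last by ring.
  by rewrite x0 expr0n oppr0 => /eqP; rewrite expf_eq0 (negPf nzC).
pose z := C%:R / (2 * x%:~R) : 'F_p.
have z2 : z ^+ 2 = -1.
  rewrite /z expr_div_n E4 (_ : 4 * _ = (2 * x%:~R) ^+ 2); last by ring.
  by rewrite mulNr divff ?expf_neq0.
have nzz : z != 0 by rewrite mulf_neq0 ?invr_eq0.
have : z ^+ (2 * n) = 1.
  apply: (mulfI nzz); rewrite mulr1 -exprS -[RHS]expf_card card_Fp //.
  by rewrite def_2n.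
rewrite exprM z2 -signr_odd /n oddD oddM /= expr1 => /eqP.
rewrite eq_sym -subr_eq0 opprK; have := @pchar_natr_neq0 'F_p p 2 pcharp.
by rewrite -[1 + 1]/2%:R => /(_ p_gt2)/negPf->.
Qed.

End PrimeField.

(** * Evaluations modulo p *)

Section ModuloPrime.
Variables (F : fieldType) (p n : nat).
Hypotheses (pcharF : p \in [pchar F]) (def_p : p = (2 * n).+1) (p_gt3 : (3 < p)%N).

Lemma natr_unit_upto_pred N : (N < p)%N -> natr_unit_upto F N.
Proof.
move=> ltNp j /andP[j_gt0 lejN]; apply: pchar_natr_neq0 pcharF _.
by rewrite j_gt0 (leq_ltn_trans lejN).
Qed.

Lemma double_half : 2 * n%:R = -1 :> F.
Proof.
apply/eqP; rewrite -addr_eq0 -natrM natr1 -def_p.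
by rewrite -(dvdn_pcharf pcharF).
Qed.

Lemma two_neq0 : 2 != 0 :> F.
Proof. by apply: pchar_natr_neq0 pcharF _; lia. Qed.

Lemma four_neq0 : 4 != 0 :> F.
Proof. by apply: pchar_natr_neq0 pcharF _; lia. Qed.

(** Wilson's theorem is the case j = 0; the step uses p - 1 - j = -(j+1) modulo p. *)
Lemma fact_reflect j : (j < p)%N -> (p.-1 - j)`!%:R * j`!%:R = (-1) ^+ j.+1 :> F.
Proof.
have p_prime := pcharf_prime pcharF.
elim: j => [|j IH] ltjp.
  rewrite subn0 fact0 mulr1 expr1; apply/eqP; rewrite -addr_eq0 natr1.
  by rewrite -(dvdn_pcharf pcharF) -Wilson // prime_gt1.
have Ej : (p.-1 - j = (p.-1 - j.+1).+1)%N by lia.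
have Ejr : (p.-1 - j)%:R = - j.+1%:R :> F.
  apply/eqP; rewrite -addr_eq0 -natrD (_ : _ + _ = p)%N; last by lia.
  by rewrite -(dvdn_pcharf pcharF).
have nzj : j.+1%:R != 0 :> F by apply: pchar_natr_neq0 pcharF _; lia.
have := IH (ltnW ltjp); rewrite Ej factS natrM -Ej Ejr => {}IH.
by rewrite exprS -IH factS natrM; ring.
Qed.

(** Dixon's formula cleared of denominators, by induction along [dixon_sumSS]. *)
Lemma dixon_sumE m : natr_unit_upto F (2 * m) ->
  dixon_sum F (2 * m) * m`!%:R ^+ 3 = (-1) ^+ m * (3 * m)`!%:R.
Proof.
elim: m => [|m IH] nz.
  by rewrite /dixon_sum big_nat1 bin0 !fact0; ring.
have nz1 : (2 * m).+1%:R != 0 :> F by apply: nz; lia.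
have nz2 : (2 * m).+2%:R != 0 :> F by apply: nz; lia.
rewrite (_ : 2 * m.+1 = (2 * m).+2)%N; last by lia.
rewrite (_ : 3 * m.+1 = (3 * m).+3)%N; last by lia.
have E := dixon_sumSS nz1 nz2.
have IH' : dixon_sum F (2 * m) * m`!%:R ^+ 3 = (-1) ^+ m * (3 * m)`!%:R.
  by apply: IH => j ?; apply: nz; lia.
apply: (mulfI (expf_neq0 2 nz2)); rewrite !factS !natrM.
transitivity ((2 * m).+2%:R ^+ 2 * dixon_sum F (2 * m).+2 *
    (m.+1%:R * m`!%:R) ^+ 3); first by ring.
move/eqP: E; rewrite addr_eq0 => /eqP->.
transitivity (- (3 * (3 * (2 * m)%:R + 2) * (3 * (2 * m)%:R + 4)) * m.+1%:R ^+ 3 *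
    (dixon_sum F (2 * m) * m`!%:R ^+ 3)); first by ring.
by rewrite IH' [(-1) ^+ m.+1]exprS; ring.
Qed.

(** Multiplied by m!^4 both sides equal -1: the left by Dixon and the value of (3m)! m!, the right
    as (2m)!^2. *)
Lemma dixon_sum_pchar m : n = (2 * m)%N -> dixon_sum F n = 'C(2 * m, m)%:R ^+ 2.
Proof.
move=> def_n; have nzm : m`!%:R != 0 :> F by apply: pchar_fact_neq0 pcharF _; lia.
have E := @dixon_sumE m (@natr_unit_upto_pred (2 * m) _).
have E1 := @fact_reflect m; rewrite (_ : p.-1 - m = 3 * m)%N in E1; last by lia.
have E2 := @fact_reflect n; rewrite (_ : p.-1 - n = 2 * m)%N in E2; last by lia.
apply: (mulIf (expf_neq0 4 nzm)); rewrite def_n.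
have -> : dixon_sum F (2 * m) * m`!%:R ^+ 4 =
  dixon_sum F (2 * m) * m`!%:R ^+ 3 * m`!%:R by ring.
rewrite E ?def_p; last by lia.
rewrite -mulrA E1; last by lia.
have -> : 'C(2 * m, m)%:R ^+ 2 * m`!%:R ^+ 4 =
    ('C(2 * m, m) * (m`! * (2 * m - m)`!))%N%:R ^+ 2 :> F.
  by rewrite (_ : 2 * m - m = m)%N ?natrM; [ring | lia].
rewrite bin_fact; last by lia.
have := E2; rewrite def_n -expr2 => ->; last by lia.
by rewrite !exprS exprM sqrrN !expr1n mulrCA -expr2 sqrr_sign.
Qed.

(** Along even indices the recurrence meets a coefficient divisible by p before reaching n; from
    there on all sums vanish. *)
Lemma sum_alt_wp_pchar : ~~ odd n -> \sum_(0 <= k < n.+1) alt_wp_term F n k = 0.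
Proof.
move=> even_n.
pose s m := \sum_(0 <= k < (2 * m).+1) alt_wp_term F (2 * m) k.
have [m def_n] : exists m, n = (2 * m)%N by exists n./2; lia.
have sS j : (j < m)%N ->
    (3 * (2 * j)%:R + 1) * (3 * (2 * j)%:R + 5) = 0 :> F \/ s j = 0 ->
    s j.+1 = 0.
  move=> ltjm h; have := @sum_alt_wp_termSS F (2 * j).
  have nz : natr_unit_upto F (2 * j).+2 by apply: natr_unit_upto_pred; lia.
  move/(_ nz); rewrite -/(s j).
  have -> : 3 * (3 * (2 * j)%:R + 1) * (3 * (2 * j)%:R + 5) * s j = 0.
    by case: h => [h | ->]; rewrite ?mulr0 // -(mulrA 3) h mulr0 mul0r.
  rewrite addr0 => /eqP; rewrite mulf_eq0 expf_eq0 /= (negPf (nz (2 * j).+1 _)) //=.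
  by rewrite /s (_ : 2 * j.+1 = (2 * j).+2)%N; [move/eqP | lia].
have [j [ltjm Ej]] : exists j, (j < m)%N /\
    (3 * (2 * j)%:R + 1) * (3 * (2 * j)%:R + 5) = 0 :> F.
  have p_prime := pcharf_prime pcharF.
  have p0 : p%:R = 0 :> F by apply: pcharf0.
  have: (3 %| p)%N = false.
    by rewrite dvdn_prime2 //; apply/negbTE; lia.
  move=> ndvd3.
  (* The witness solves 6j + 1 = p or 6j + 5 = p according to p modulo 3. *)
  have [E | E] : (p %% 3 = 1 \/ p %% 3 = 2)%N by move: ndvd3; clear; lia.
  - exists (p %/ 3)./2; split; first by lia.
    have -> : 3 * (2 * (p %/ 3)./2)%:R + 1 = p%:R :> F.
      by rewrite -natrM natr1; congr _%:R; lia.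
    by rewrite p0 mul0r.
  - exists (p.-2 %/ 3)./2; split; first by lia.
    have -> : 3 * (2 * (p.-2 %/ 3)./2)%:R + 5 = p%:R :> F.
      by rewrite -natrM -natrD; congr _%:R; lia.
    by rewrite p0 mulr0.
suff: s m = 0 by rewrite /s -def_n.
elim: m {def_n} ltjm sS => // m IH; rewrite ltnS leq_eqVlt => /predU1P[E | ltjm] sS.
  by apply: sS => //; left; rewrite -E.
by apply: (sS m (ltnSn m)); right; apply: IH ltjm _ => i ltim; apply: (sS i (ltnW ltim)).
Qed.

Lemma watson_sum_odd N : (N < p)%N -> odd N -> watson_sum F N = 0.
Proof.
elim/ltn_ind: N => -[//|[|N]] IH ltNp oddN.
  rewrite /watson_sum big_nat_recr // big_nat1 /watson_sum_term /=.
  rewrite !bin0 ?bin1 ?expr0 ?expr1 ?mulr1 ?mul1r. 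
  by field; exact: four_neq0.
have nz : natr_unit_upto F N.+2 by apply: natr_unit_upto_pred.
have nz1 : N.+1%:R != 0 :> F by apply: nz; lia.
have nz2 : N.+2%:R != 0 :> F by apply: nz; lia.
have := watson_sumSS two_neq0 nz1 nz2.
rewrite (IH N) //; [|by lia|by rewrite /= negbK in oddN].
by move/eqP; rewrite mulr0 mulf_eq0 expf_eq0 /= (negPf nz2) => /eqP.
Qed.

Lemma watson_sum_even m : (2 * m < p)%N ->
  watson_sum F (2 * m) = ('C(2 * m, m)%:R / 4 ^+ m) ^+ 2.
Proof.
elim: m => [|m IH] ltmp.
  by rewrite /watson_sum big_nat1 /watson_sum_term muln0 bin0 !expr0 divr1; ring.
have nz : natr_unit_upto F (2 * m).+2 by apply: natr_unit_upto_pred; lia.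
have nz1 : (2 * m).+1%:R != 0 :> F by apply: nz; lia.
have nz2 : (2 * m).+2%:R != 0 :> F by apply: nz; lia.
have E := @watson_sumSS F (2 * m) two_neq0 nz1 nz2.
have E2 := central_binS F m.
rewrite (_ : 2 * m.+1 = (2 * m).+2)%N in E2 *; last by lia.
apply: (mulfI (expf_neq0 2 nz2)); rewrite E IH; last by lia.
rewrite -!exprMn; congr (_ ^+ 2).
rewrite (_ : (2 * m).+2%:R = 2 * m.+1%:R); last by rewrite -natrM; congr _%:R; lia.
rewrite [4 ^+ m.+1]exprS.
transitivity (2 * (m.+1%:R * 'C((2 * m).+2, m.+1)%:R) / (4 * 4 ^+ m) : F); last by ring.
rewrite E2 -natr1 natrM; field.
by rewrite expf_neq0 // (natrM _ 2 2) mulf_neq0 // two_neq0.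
Qed.

(** In characteristic zero C(2k, k) = (-4)^k C(-1/2, k), and n = -1/2 modulo p. *)
Lemma central_bin_half k : (k <= n)%N ->
  'C(2 * k, k)%:R = (- 4) ^+ k * 'C(n, k)%:R :> F.
Proof.
elim: k => [|k IH] lekn; first by rewrite muln0 !bin0 expr0 mulr1.
have nz : k.+1%:R != 0 :> F by apply: pchar_natr_neq0 pcharF _; lia.
apply: (mulfI nz); rewrite central_binS IH; last by lia.
rewrite [RHS]mulrCA natr_bin_right [(- 4) ^+ k.+1]exprS; have := double_half.
move: (n%:R) => x E.
have -> : 2 * (2 * k%:R + 1) = - 4 * (x - k%:R) :> F.
  transitivity (4 * k%:R - 2 * - (1) : F); first by ring.
  by rewrite -E; ring.
by ring.
Qed.

(* Modulo p, both terms are (1/4)_j (3/4)_j (1/2)_j / j!^3, as n = -1/2 and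
   N = -1/4 or -3/4. *)
Lemma franel_quad_watson N : (N <= n)%N ->
    16 * N%:R * (N%:R + 1) = - 3 :> F ->
  franel_quad F n = watson_sum F N.
Proof.
move=> leNn EN; rewrite /watson_sum.
have -> : \sum_(0 <= k < N.+1) watson_sum_term F N k =
    \sum_(0 <= k < n.+1) watson_sum_term F N k.
  rewrite [RHS](@big_cat_nat _ _ _ N.+1) //= [X in _ = _ + X]big1_seq ?addr0 // => k.
  by rewrite /= mem_index_iota => /andP[ltNk _]; apply: watson_sum_term_small.
apply: eq_big_nat => j /andP[_ ltjn]; rewrite /franel_quad_term /watson_sum_term.
suff -> : 'C(n, 2 * j)%:R * 'C(n + j, j)%:R =
    (-1) ^+ j * ('C(N, j)%:R * 'C(N + j, j)%:R) :> F.
  by rewrite [(- 4^-1) ^+ j]exprNn exprVn; ring.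
elim: j ltjn => [|j IH] ltjn; first by rewrite muln0 !bin0 expr0; ring.
have nz1 : j.+1%:R != 0 :> F by apply: pchar_natr_neq0 pcharF _; lia.
have nz2 : (2 * j).+1%:R != 0 :> F by apply: pchar_natr_neq0 pcharF _; lia.
have nz8 : 8 != 0 :> F.
  by rewrite (_ : 8 = 2 ^+ 3) ?expf_neq0 ?two_neq0 // -natrX.
have E1 := natr_bin_right F n (2 * j); have E2 := natr_bin_right F n (2 * j).+1.
have E3 := natr_bin_diag F (n + j) j.
have E4 := natr_bin_right F N j; have E5 := natr_bin_diag F (N + j) j.
have {}IH := IH (ltnW ltjn).
rewrite (_ : 2 * j.+1 = (2 * j).+2)%N ?addnS; last by lia.
apply: (mulfI nz1); apply: (mulfI nz1); apply: (mulfI nz2); apply: (mulfI nz8).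
transitivity (4 * ((2 * j).+1%:R * ((2 * j).+2%:R * 'C(n, (2 * j).+2)%:R)) *
    (j.+1%:R * 'C((n + j).+1, j.+1)%:R) : F).
  by rewrite [(2 * j).+2%:R](_ : _ = 2 * j.+1%:R); [ring | rewrite -natrM; congr _%:R; lia].
rewrite E2 [(2 * j).+1%:R * _]mulrCA E1 -E3.
transitivity (8 * (2 * j).+1%:R * (-1) ^+ j.+1 * (j.+1%:R * 'C(N, j.+1)%:R) *
    (j.+1%:R * 'C((N + j).+1, j.+1)%:R) : F); last by ring.
rewrite E4 -E5.
transitivity ((2 * n%:R - 4 * j%:R) * (2 * n%:R - 4 * j%:R - 2) *
   (2 * n%:R + 2 * j%:R + 2) / 2 * ('C(n, 2 * j)%:R * 'C(n + j, j)%:R) : F).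
  by field; exact: two_neq0.
rewrite IH double_half [(-1) ^+ j.+1]exprS.
(* The ratio of consecutive terms involves N only through N(N+1), so N = -1/4 and N = -3/4 are
   treated together. *)
transitivity ((2 * j%:R + 1) * (- (16 * N%:R * (N%:R + 1)) + 16 * j%:R ^+ 2 +
    16 * j%:R) / 2 * ((-1) ^+ j * ('C(N, j)%:R * 'C(N + j, j)%:R)) : F).
  by rewrite EN; field; exact: two_neq0.
by field; exact: two_neq0.
Qed.

End ModuloPrime.

(** * Harmonic numbers modulo p, and the resulting form of the two sums *)

Section HarmonicModuloPrime.
Variables (F : fieldType) (p n : nat).
Hypotheses (pcharF : p \in [pchar F]) (def_p : p = (2 * n).+1) (p_gt3 : (3 < p)%N).

Let nz2 : 2 != 0 :> F := two_neq0 pcharF def_p p_gt3.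
Let n2 : 2 * n%:R = -1 :> F := double_half pcharF def_p.
Let unitn j : (0 < j < p)%N -> j%:R != 0 :> F := @pchar_natr_neq0 F p j pcharF.

(** Going from k to k+1 rests on n - k = -(2k+1)/2 modulo p. *)
Lemma harm_double k : (k <= n)%N ->
  2 * harm F (2 * k) = harm F (n - k) + harm F k - harm F n.
Proof.
elim: k => [|k IH] lekn; first by rewrite muln0 subn0 !harm0; ring.
rewrite (_ : 2 * k.+1 = (2 * k).+2)%N; last by lia.
have En : (n - k = (n - k.+1).+1)%N by lia.
have := IH (ltnW lekn); rewrite En !harmS => {}IH.
have nz1 : (2 * k).+1%:R != 0 :> F by apply: unitn; lia.
have nz3 : k.+1%:R != 0 :> F by apply: unitn; lia.
have -> : (2 * k).+2%:R = 2 * k.+1%:R :> F by rewrite -natrM; congr _%:R; lia.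
have E : (n - k.+1).+1%:R = - (2 * k).+1%:R / 2 :> F.
  rewrite -En natrB; last by lia.
  apply: (mulfI nz2); rewrite mulrBr n2; field; exact: nz2.
rewrite !mulrDr IH.
rewrite E; move: nz1 nz3.
move: ((2 * k).+1%:R : F) (k.+1%:R : F) => u v nzu nzv.
by field; rewrite oppr_eq0 nzu nzv nz2.
Qed.

Lemma harm_double_sub k : (k <= n)%N ->
  harm F (2 * k) - harm F k = dbin F n k / 2 - harm F n / 2.
Proof.
move=> lekn; apply: (mulfI nz2); rewrite mulrBr harm_double // /dbin.
by field; exact: nz2.
Qed.

Lemma bin_pred_pchar j : (j < p)%N -> 'C(p.-1, j)%:R = (-1) ^+ j :> F.
Proof.
elim: j => [|j IH] ltjp; first by rewrite bin0 expr0.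
have nzj : j.+1%:R != 0 :> F by apply: unitn; lia.
apply: (mulfI nzj); rewrite natr_bin_right IH; last by lia.
have -> : p.-1%:R = -1 :> F.
  by apply/eqP; rewrite -addr_eq0 natr1 prednK ?(pcharf0 pcharF) //; lia.
by rewrite [(-1) ^+ j.+1]exprS -natr1; ring.
Qed.

Lemma sum_alt_harm m : natr_unit_upto F (2 * m) ->
  \sum_(1 <= k < (2 * m).+1) (-1) ^+ k.-1 / k%:R = harm F (2 * m) - harm F m.
Proof.
elim: m => [|m IH] nz; first by rewrite big_nil muln0 subrr.
rewrite (_ : 2 * m.+1 = (2 * m).+2)%N in nz *; last by lia.
rewrite big_nat_recr //= big_nat_recr //= IH => [|j ?]; last by apply: nz; lia.
rewrite exprS exprM sqrrN !expr1n !harmS.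
have nzm : m.+1%:R != 0 :> F.
  have : (2 * m).+2%:R != 0 :> F by apply: nz; lia.
  by rewrite (_ : (2 * m).+2 = 2 * m.+1)%N ?natrM ?mulf_eq0 ?negb_or; [case/andP | lia].
have -> : (2 * m).+2%:R = 2 * m.+1%:R :> F by rewrite -natrM; congr _%:R; lia.
have nz1 : (2 * m).+1%:R != 0 :> F by apply: nz; lia.
move: nz1 nzm; move: ((2 * m).+1%:R : F) (m.+1%:R : F) => u v nzu nzv.
by field; rewrite nzu nzv nz2.
Qed.

(** Here Q is the Fermat quotient, and 2Q = (2^p - 2)/p is the sum of C(p, k)/p, that is of
    (-1)^(k-1)/k modulo p. This equals H_{2n} - H_n, where H_{2n} = 0. *)
Lemma harm_half Q : (2 ^ p.-1 = 1 + p * Q)%N -> harm F n = - 2 * Q%:R.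
Proof.
move=> defQ; have p_prime := pcharf_prime pcharF; have p_gt0 := prime_gt0 p_prime.
pose d k := ('C(p, k) %/ p)%N.
have dE k : (0 < k < p)%N -> ('C(p, k) = p * d k)%N.
  by move=> ltkp; rewrite mulnC divnK // prime_dvd_bin.
have E2 : (2 * Q = \sum_(1 <= k < p) d k)%N.
  apply/eqP; rewrite -(eqn_pmul2l p_gt0) big_distrr /=.
  have sumC : (2 ^ p = \sum_(0 <= i < p.+1) 'C(p, i))%N.
    rewrite [LHS](Pascal 1 1 p) big_mkord; apply: eq_bigr => i _.
    by rewrite !exp1n !muln1.
  move: sumC; rewrite -{1}(prednK p_gt0) expnS defQ big_nat_recr //= binn.
  rewrite big_ltn // bin0 => E.
  rewrite -(@eq_big_nat _ _ _ _ _ (fun k => 'C(p, k))) => [|k]; last exact: dE.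
  by apply/eqP; lia.
have dF k : (1 <= k < p)%N -> (d k)%:R = (-1) ^+ k.-1 / k%:R :> F.
  move=> /andP[k_gt0 ltkp]; have nzk : k%:R != 0 :> F by apply: unitn; rewrite k_gt0.
  apply: (mulIf nzk); rewrite mulfVK // -bin_pred_pchar; last by lia.
  rewrite -natrM; congr _%:R; apply/eqP; rewrite -(eqn_pmul2l p_gt0).
  have := mul_bin_diag p k.-1; rewrite prednK // => ->.
  by rewrite mulnA -dE ?k_gt0 // mulnC.
have E3 : 2 * Q%:R = harm F (2 * n) - harm F n.
  rewrite -sum_alt_harm; last by apply: (natr_unit_upto_pred pcharF); rewrite def_p.
  rewrite -natrM E2 natr_sum -def_p.
  by apply: eq_big_nat => k; exact: dF.
have := @harm_double n (leqnn n); rewrite subnn harm0 add0r subrr => /eqP.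
rewrite mulf_eq0 (negPf nz2) => /eqP E4.
by rewrite mulNr E3 E4; ring.
Qed.

(** Treats both bases at once: x = 1 for -64, and x = -1 with n even for 64. The conditions on x
    make the weight x^k invariant under k -> n - k. *)
Lemma weighted_sum (x q : F) : x ^+ 2 = 1 -> x ^+ n = 1 -> harm F n = - 2 * q ->
  12 * (\sum_(0 <= k < n.+1) k%:R * 'C(2 * k, k)%:R ^+ 3 / (- 64 * x) ^+ k *
     (harm F (2 * k) - harm F k)) =
  (\sum_(0 <= k < n.+1) x ^+ k * wp_term F n k) -
  (2 + 3 * q) * \sum_(0 <= k < n.+1) x ^+ k * 'C(n, k)%:R ^+ 3.
Proof.
move=> x2 xn hn.
have nzx : x != 0 by apply: contra_eq_neq x2 => ->; rewrite expr0n eq_sym oner_eq0.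
have nz4 := four_neq0 pcharF def_p p_gt3.
have xrev k : (k <= n)%N -> x ^+ (n - k) = x ^+ k.
  move=> lekn; apply: (mulIf (expf_neq0 k nzx)).
  by rewrite -exprD subnK // xn -exprD addnn -mul2n exprM x2 expr1n.
pose c k := x ^+ k * 'C(n, k)%:R ^+ 3.
have crev k : (k <= n)%N -> c (n - k)%N = c k.
  by move=> lekn; rewrite /c xrev // bin_sub.
pose f := \sum_(0 <= k < n.+1) c k.
pose a := \sum_(0 <= k < n.+1) k%:R * c k.
pose b := \sum_(0 <= k < n.+1) c k * dbin F n k.
pose e := \sum_(0 <= k < n.+1) k%:R * c k * dbin F n k.
(* The reflection k -> n - k changes the sign of [dbin n k]. *)
have b0 : b = 0.
  have : b = - b.
    rewrite /b {1}big_nat_rev -sumrN; apply: eq_big_nat => k /andP[_ ltkn].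
    by rewrite add0n subSS crev // -mulrN /dbin subKn // opprB.
  move/eqP; rewrite -subr_eq0 opprK -mulr2n -mulr_natl mulf_eq0 (negPf nz2).
  by move/eqP.
have a2 : 2 * a = n%:R * f.
  have : a = n%:R * f - a.
    rewrite /a {1}big_nat_rev /f mulr_sumr -sumrB; apply: eq_big_nat => k /andP[_ ltkn].
    by rewrite add0n subSS crev // natrB //; ring.
  by move=> E; rewrite mulr_natl mulr2n {2}E addrC subrK.
have -> : \sum_(0 <= k < n.+1) x ^+ k * wp_term F n k = 2 * f + 3 * (2 * e - n%:R * b).
  rewrite /f /e /b !(mulr_sumr, =^~ sumrB, =^~ big_split) /=.
  by apply: eq_bigr => k _; rewrite /wp_term /c; ring.
have -> : \sum_(0 <= k < n.+1) k%:R * 'C(2 * k, k)%:R ^+ 3 / (- 64 * x) ^+ k *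
     (harm F (2 * k) - harm F k) = e / 2 + q * a.
  rewrite /e /a mulr_suml mulr_sumr -big_split /=.
  apply: eq_big_nat => k /andP[_ ltkn].
  rewrite harm_double_sub // (central_bin_half pcharF def_p p_gt3) // hn /c.
  have xk : x ^+ k * x ^+ k = 1 by rewrite -exprD addnn -mul2n exprM x2 expr1n.
  have -> : (- 64 * x) ^+ k = ((- 4) ^+ k) ^+ 3 * x ^+ k :> F.
    by rewrite -exprM mulnC exprM -exprMn; congr (_ ^+ _); ring.
  rewrite exprMn invfM (_ : (x ^+ k)^-1 = x ^+ k); last first.
    by apply: (mulfI (expf_neq0 k nzx)); rewrite divff ?expf_neq0.
  have nz4k : (- 4) ^+ k != 0 :> F by rewrite expf_neq0 // oppr_eq0.
  by move: nz4k; move: ((- 4) ^+ k : F) => z nzz; field; rewrite nzz nz2.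
rewrite b0 mulr0 subr0 -/f.
transitivity (6 * e + 6 * q * (2 * a)); first by field; exact: nz2.
rewrite a2 mulrA; transitivity (6 * e + 3 * q * (2 * n%:R) * f); first by ring.
by rewrite n2; ring.
Qed.

Lemma franel_watson N : p = (4 * N).+1 \/ p = (4 * N).+3 ->
  franel F n = 2 ^+ n * watson_sum F N.
Proof.
move=> pN; rewrite franel_quadE //; last first.
  by apply: (natr_unit_upto_pred pcharF); rewrite def_p; lia.
congr (_ * _); apply: (franel_quad_watson pcharF def_p p_gt3); first by lia.
have p0 : p%:R = 0 :> F := pcharf0 pcharF.
have -> : 16 * N%:R * (N%:R + 1) = 4 * N%:R * (4 * N%:R + 4) :> F by ring.
case: pN => pN; move: p0; rewrite pN => p0.
  have -> : 4 * N%:R = (4 * N).+1%:R - 1 :> F by ring.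
  by rewrite p0; ring.
have -> : 4 * N%:R = (4 * N).+3%:R - 3 :> F by ring.
by rewrite p0; ring.
Qed.

Lemma franel_eq0 : (p %% 8 = 5 \/ p %% 8 = 7)%N -> franel F n = 0.
Proof.
move=> p57; have [N [oddN ltNp pN]] : exists N, [/\ odd N, (N < p)%N &
    p = (4 * N).+1 \/ p = (4 * N).+3].
  by exists (p %/ 4)%N; split; lia.
by rewrite (franel_watson pN) (watson_sum_odd pcharF def_p p_gt3) // mulr0.
Qed.

Lemma franel_bin m : p = (8 * m).+1 \/ p = (8 * m).+3 ->
  franel F n = 2 ^+ n * 'C(n, m)%:R ^+ 2.
Proof.
move=> pm; have le_mn : (m <= n)%N by lia.
rewrite (@franel_watson (2 * m)); last by lia.
rewrite (watson_sum_even pcharF def_p p_gt3); last by lia.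
rewrite (central_bin_half pcharF def_p p_gt3) // mulrAC [(- 4) ^+ m]exprNn.
rewrite mulfK ?expf_neq0 ?(four_neq0 pcharF def_p p_gt3) //.
by rewrite exprMn -exprM mulnC exprM sqrrN expr1n expr1n mul1r.
Qed.

End HarmonicModuloPrime.

(** * The sums over ['F_p] and the sign of the Franel number *)

Section PrimeFieldEvaluation.
Variables (p n : nat).
Hypotheses (p_prime : prime p) (def_p : p = (2 * n).+1) (p_gt3 : (3 < p)%N).

Let pcharp : p \in [pchar 'F_p] := pchar_Fp p_prime.

Lemma sqr_exp_half (z : 'F_p) : z != 0 -> (z ^+ 2) ^+ n = 1.
Proof.
move=> nzz; apply: (mulfI nzz); rewrite -exprM mulr1 -exprS -def_p.
by rewrite -[X in z ^+ X](card_Fp p_prime) expf_card.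
Qed.

Lemma legendreN1 : legendre (-1) p = (-1) ^+ n.
Proof.
have intF (z : int) : (z%:~R == 0 :> 'F_p) = (p%:Z %| z)%Z := intr_eq0_pchar z pcharp.
rewrite /legendre ifF; last first.
  rewrite dvdzE /=; apply/negbTE/negP => /dvdn_leq; lia.
have N1 : (-1 : 'F_p) != 1.
  have := two_neq0 pcharp def_p p_gt3; apply: contra_neq => E.
  by rewrite mulr2n -{1}E addNr.
rewrite -signr_odd; case: (boolP (odd n)) => odd_n /=.
  rewrite expr1 ifF //; apply/negbTE/existsPn => b; apply/negP.
  rewrite eqz_mod_dvd opprK -intF rmorphD rmorphXn /= addr_eq0 => /eqP b2.
  have nzb : (b%:Z%:~R : 'F_p) != 0.
    by apply: contra_eq_neq b2 => ->; rewrite expr0n eq_sym oppr_eq0 oner_eq0.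
  by have := sqr_exp_half nzb; rewrite b2 -signr_odd odd_n expr1 => /eqP; rewrite (negPf N1).
rewrite expr0 ifT //; apply/existsP.
have [z z2] : exists z : 'F_p, z ^+ 2 = -1.
  have cardF : #|'F_p| = (2 * (2 * n./2)).+1 by rewrite card_Fp //; lia.
  have M_gt0 : (0 < n./2)%N by lia.
  exists (fgen (isT : (0 < 2)%N) M_gt0 cardF ^+ n./2).
  by rewrite -exprM mulnC; exact: gen_half.
have ltzp : (z < p)%N by rewrite -[X in (_ < X)%N](Fp_cast p_prime).
exists (Ordinal ltzp); rewrite eqz_mod_dvd opprK -intF rmorphD rmorphXn /=.
by rewrite -[_%:~R]/(z%:R) natr_Zp z2 addNr.
Qed.

Lemma sum_neg64 Q : (2 ^ p.-1 = 1 + p * Q)%N ->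
  12 * (\sum_(0 <= k < n.+1) k%:R * 'C(2 * k, k)%:R ^+ 3 / (- 64) ^+ k *
     (harm 'F_p (2 * k) - harm 'F_p k)) =
  2 * (-1) ^+ n - (2 + 3 * Q%:R) * franel 'F_p n.
Proof.
move=> defQ; have hn := harm_half pcharp def_p p_gt3 defQ.
have := weighted_sum pcharp def_p p_gt3 (expr1n _ 2) (expr1n _ n) hn.
rewrite mulr1 => ->; congr (_ - _ * _); last first.
  by apply: eq_bigr => k _; rewrite expr1n mul1r.
transitivity (\sum_(0 <= k < n.+1) wp_term 'F_p n k).
  by apply: eq_bigr => k _; rewrite expr1n mul1r.
have: natr_unit_upto 'F_p n by apply: (natr_unit_upto_pred pcharp); lia.
elim: n => [|m IH] nz.
  by rewrite big_nat1 /wp_term bin0 /dbin subrr; ring.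
rewrite sum_wp_termS // IH => [|j ?]; last by apply: nz; lia.
by rewrite [(-1) ^+ m.+1]exprS; ring.
Qed.

Lemma sum_pos64 Q : ~~ odd n -> (2 ^ p.-1 = 1 + p * Q)%N ->
  12 * (\sum_(0 <= k < n.+1) k%:R * 'C(2 * k, k)%:R ^+ 3 / 64 ^+ k *
     (harm 'F_p (2 * k) - harm 'F_p k)) =
  - (2 + 3 * Q%:R) * dixon_sum 'F_p n.
Proof.
move=> even_n defQ; have hn := harm_half pcharp def_p p_gt3 defQ.
have N1n : (-1) ^+ n = 1 :> 'F_p by rewrite -signr_odd (negPf even_n).
have N12 : (-1) ^+ 2 = 1 :> 'F_p by rewrite sqrrN expr1n.
have := weighted_sum pcharp def_p p_gt3 N12 N1n hn.
rewrite mulrN1 opprK => ->.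
by rewrite (sum_alt_wp_pchar pcharp def_p p_gt3) // sub0r mulNr.
Qed.

Lemma sqr_plus_two_sqr_mod8 (x y : int) : p%:Z = x ^+ 2 + 2 * y ^+ 2 ->
  exists m, p = (8 * m).+1 \/ p = (8 * m).+3.
Proof.
move=> Ex; suff [k Ek] : exists k : int, p%:Z = 8 * k + 1 \/ p%:Z = 8 * k + 3.
  by exists (p %/ 8)%N; move: Ek; clear; lia.
have Ep : p%:Z = 2 * n%:Z + 1 by rewrite def_p; clear; lia.
have [a [Ea | Ea]] := int_parity x.
  by move: Ep; rewrite Ex Ea; clear; lia.
have [b Eb] := int_parity a; have [c Ec] := int_parity y.
exists ((p%:Z - 1) %/ 8)%Z; rewrite Ex Ea; clear -Eb Ec.
by case: Eb Ec => -> [] ->; lia.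
Qed.

(** [franel_bin] leaves a factor 2^n. Since x^2 = -2 y^2 modulo p, -2 is a square, so 2^n = (-1)^n
    by Euler's criterion. *)
Lemma franel_sqr_plus_two_sqr (x y : int) : p%:Z = x ^+ 2 + 2 * y ^+ 2 ->
  franel 'F_p n = (-1) ^+ n * (4 * x%:~R ^+ 2).
Proof.
move=> Ex.
have Cx m : p = (8 * m).+1 \/ p = (8 * m).+3 ->
    ('C(n, m)%:R : 'F_p) ^+ 2 = 4 * x%:~R ^+ 2.
  case=> pm.
    have -> : n = (4 * m)%N by lia.
    exact: (sqr_plus_two_sqr_bin1 p_prime pm Ex).
  have -> : n = (4 * m + 1)%N by lia.
  by apply: (sqr_plus_two_sqr_bin3 p_prime _ Ex); rewrite pm addn3.
have [m pm] := sqr_plus_two_sqr_mod8 Ex.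
rewrite (franel_bin pcharp def_p p_gt3 pm) (Cx m pm); congr (_ * _).
have nzx : x%:~R != 0 :> 'F_p.
  have nzC : 'C(n, m)%:R != 0 :> 'F_p by apply: pchar_bin_neq0 pcharp _; lia.
  apply: contraNneq nzC => x0; rewrite -sqrf_eq0 (Cx m pm) x0.
  by rewrite expr0n mulr0.
have E : x%:~R ^+ 2 = - 2 * y%:~R ^+ 2 :> 'F_p.
  have : p%:Z%:~R = 0 :> 'F_p := pcharf0 pcharp.
  rewrite Ex rmorphD rmorphM !rmorphXn /= => /eqP.
  by rewrite addr_eq0 mulNr => /eqP.
have nzy : y%:~R != 0 :> 'F_p.
  apply: contraNneq nzx => y0; rewrite -sqrf_eq0 E y0.
  by rewrite expr0n mulr0.
have E1 : (-1) ^+ n * 2 ^+ n = 1 :> 'F_p.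
  have := sqr_exp_half nzx; rewrite E exprMn sqr_exp_half // mulr1 => E1.
  by rewrite -exprMn mulN1r E1.
have nzs : (-1) ^+ n != 0 :> 'F_p by rewrite signr_eq0.
by apply: (mulfI nzs); rewrite E1 -expr2 sqrr_sign.
Qed.

End PrimeFieldEvaluation.

(** * Reduction of p-integral rationals *)

Section Reduction.
Variable p : nat.
Hypothesis p_prime : prime p.

Let pcharp : p \in [pchar 'F_p] := pchar_Fp p_prime.
Let intF (z : int) : (z%:~R == 0 :> 'F_p) = (p%:Z %| z)%Z := intr_eq0_pchar z pcharp.

(* [r] is p-integral and [z] is its residue. *)
Definition reduces_to (r : rat) (z : 'F_p) := exists a b : int,
  [/\ (b%:~R : 'F_p) != 0, r = a%:~R / b%:~R & z = a%:~R / b%:~R].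

Lemma intr_rat_neq0 (b : int) : (b%:~R : 'F_p) != 0 -> (b%:~R : rat) != 0.
Proof. by rewrite intr_eq0; apply: contraNneq => ->. Qed.

Lemma reduces_to_int (a : int) : reduces_to a%:~R a%:~R.
Proof. by exists a, 1; rewrite oner_eq0 !divr1. Qed.

Lemma reduces_to_nat (m : nat) : reduces_to m%:R m%:R.
Proof. exact: (reduces_to_int m). Qed.

Lemma reduces_toD r z s t :
  reduces_to r z -> reduces_to s t -> reduces_to (r + s) (z + t).
Proof.
move=> [a [b [nzb -> ->]]] [c [d [nzd -> ->]]].
have nzb' := intr_rat_neq0 nzb; have nzd' := intr_rat_neq0 nzd.
exists (a * d + c * b), (b * d); split; rewrite ?rmorphD !rmorphM /=.
- by rewrite mulf_neq0.
- by rewrite addf_div.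
- by rewrite addf_div.
Qed.

Lemma reduces_toM r z s t :
  reduces_to r z -> reduces_to s t -> reduces_to (r * s) (z * t).
Proof.
move=> [a [b [nzb -> ->]]] [c [d [nzd -> ->]]].
by exists (a * c), (b * d); rewrite !rmorphM /= mulf_neq0 // !mulf_div.
Qed.

Lemma reduces_toN r z : reduces_to r z -> reduces_to (- r) (- z).
Proof. by move=> [a [b [nzb -> ->]]]; exists (- a), b; rewrite !rmorphN !mulNr. Qed.

Lemma reduces_toV r z : z != 0 -> reduces_to r z -> reduces_to r^-1 z^-1.
Proof.
move=> nzz [a [b [nzb -> def_z]]]; exists b, a; rewrite def_z !invf_div; split=> //.
by apply: contraNneq nzz => a0; rewrite def_z a0 mul0r.
Qed.

Lemma reduces_toX r z k : reduces_to r z -> reduces_to (r ^+ k) (z ^+ k).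
Proof.
move=> rz; elim: k => [|k IH]; first exact: (reduces_to_nat 1).
by rewrite !exprS; apply: reduces_toM.
Qed.

Lemma reduces_to_sum (I : eqType) (s : seq I) (f : I -> rat) (g : I -> 'F_p) :
    (forall i, i \in s -> reduces_to (f i) (g i)) ->
  reduces_to (\sum_(i <- s) f i) (\sum_(i <- s) g i).
Proof.
move=> fg; rewrite big_seq [\sum_(i <- s) g i]big_seq.
apply: (big_ind2 reduces_to) => [|? ? ? ?|//]; last exact: reduces_toD.
exact: (reduces_to_nat 0).
Qed.

Lemma Zloc_frac (a b : int) : (b%:~R : 'F_p) != 0 -> a%:~R / b%:~R \in Zloc p.
Proof.
move=> nzb; have nzb' := intr_rat_neq0 nzb; set r := _ / _.
have E : numq r * b = a * denq r.
  apply/(@intr_inj rat); rewrite !rmorphM /= numqE /r.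
  by rewrite mulrAC divfK.
have dvd_b : (denq r %| b)%Z.
  rewrite -(@Gauss_dvdzr _ (numq r)) ?E ?dvdz_mull //.
  by rewrite coprimez_sym coprimezE; exact: coprime_num_den.
rewrite inE coprime_sym prime_coprime //; apply: contra nzb => dvd_p.
by rewrite intF; apply: dvdz_trans dvd_b; rewrite dvdzE.
Qed.

Lemma reduces_to_eqmod r s z : reduces_to r z -> reduces_to s z -> eqmod_loc p r s.
Proof.
move=> rz sz; have := reduces_toD rz (reduces_toN sz); rewrite subrr.
move=> [a [b [nzb E /esym/eqP]]]; rewrite mulf_eq0 invr_eq0 (negPf nzb) orbF intF.
case/dvdzP=> c def_a; exists (c%:~R / b%:~R); first exact: Zloc_frac.
by rewrite E def_a rmorphM /= mulrAC [LHS]mulrC.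
Qed.

End Reduction.

(** The summand 2s of 12 S, multiplied by the sign s, is the source of the 1/6. *)
Lemma final_combination_neg (F : fieldType) (s S q f X : F) : 2 != 0 :> F -> 3 != 0 :> F ->
    s ^+ 2 = 1 -> 12 * S = 2 * s - (2 + 3 * q) * f -> f = s * (4 * X) ->
  s * S - 1 / 6 = - (3 * q + 2) * X / 3.
Proof.
move=> nz2 nz3 s2 ES Ef.
have nz6 : 6 != 0 :> F by rewrite (natrM _ 2 3) mulf_neq0.
have nz12 : 12 != 0 :> F by rewrite (natrM _ 2 6) mulf_neq0.
apply: (mulfI nz12); transitivity (s * (12 * S) - 2); first by field.
rewrite ES Ef; transitivity (s ^+ 2 * (2 - (2 + 3 * q) * 4 * X) - 2); first by ring.
by rewrite s2; field.
Qed.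

Lemma final_combination_pos (F : fieldType) (S q g X : F) : 2 != 0 :> F -> 3 != 0 :> F ->
    12 * S = - (2 + 3 * q) * g -> g = 4 * X ->
  S = - (X / 3) * (3 * q + 2).
Proof.
move=> nz2 nz3 ES Eg.
have nz12 : 12 != 0 :> F by rewrite (natrM _ 4 3) mulf_neq0 // (natrM _ 2 2) mulf_neq0.
by apply: (mulfI nz12); rewrite ES Eg; field.
Qed.

(** * Passing from rational harmonic sums to ['F_p] *)

Section HarmonicReduction.
Variables p n : nat.
Hypotheses (p_prime : prime p) (def_p : p = (2 * n).+1) (p_gt3 : (3 < p)%N).

Let pcharp : p \in [pchar 'F_p] := pchar_Fp p_prime.

Lemma reduces_to_natV j : (0 < j < p)%N -> reduces_to (j%:R^-1) (j%:R^-1 : 'F_p).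
Proof.
by move=> ltjp; apply: reduces_toV (pchar_natr_neq0 pcharp ltjp) (reduces_to_nat _ j).
Qed.

Lemma reduces_to_harmonic N : (N < p)%N -> reduces_to (harmonic N) (harm 'F_p N).
Proof.
move=> ltNp; apply: reduces_to_sum => j; rewrite mem_index_iota => /andP[j_gt0 ltjN].
by apply: reduces_to_natV; lia.
Qed.

(** Below 2p only the denominator j = p is divisible by p, and that only once. *)
Lemma reduces_to_p_harmonic N : (N < 2 * p)%N ->
  exists z : 'F_p, reduces_to (p%:R * harmonic N) z.
Proof.
move=> ltN2p; exists (\sum_(1 <= j < N.+1) (j == p)%:R); rewrite /harmonic mulr_sumr.
apply: reduces_to_sum => j; rewrite mem_index_iota => /andP[j_gt0 ltjN].
have [-> | neqjp] := eqVneq j p.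
  rewrite divff; first exact: (reduces_to_nat _ 1).
  by rewrite pnatr_eq0 -lt0n prime_gt0.
have nzj : j%:R != 0 :> 'F_p.
  rewrite -(dvdn_pcharf pcharp); apply/negP => /dvdnP[[|[|c]] Ec];
    by move: neqjp j_gt0 ltjN ltN2p; rewrite Ec; clear; nia.
rewrite [false%:R](_ : _ = p%:R * j%:R^-1); last by rewrite (pcharf0 pcharp) mul0r.
by apply: reduces_toM (reduces_to_nat _ _) (reduces_toV nzj (reduces_to_nat _ j)).
Qed.

(* The terms with [n < k] vanish modulo p: 'C(2k, k)^3 is divisible by p^3 while
   H_{2k} has a simple pole at p. *)
Lemma reduces_to_binomial_sum (m : rat) (mF : 'F_p) : mF != 0 -> reduces_to m mF ->
  reduces_to
    (\sum_(0 <= k < p) k%:R * 'C(2 * k, k)%:R ^+ 3 / m ^+ k *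
       (harmonic (2 * k) - harmonic k))
    (\sum_(0 <= k < n.+1) k%:R * 'C(2 * k, k)%:R ^+ 3 / mF ^+ k *
       (harm 'F_p (2 * k) - harm 'F_p k)).
Proof.
move=> nzm mR; have le_np : (n.+1 <= p)%N by lia.
have mkR k : reduces_to (m ^+ k)^-1 (mF ^+ k)^-1.
  by apply: reduces_toV; [exact: expf_neq0 | exact: reduces_toX].
rewrite (@big_cat_nat _ _ _ n.+1) //= -[X in reduces_to _ X]addr0.
apply: reduces_toD.
  apply: reduces_to_sum => k; rewrite mem_index_iota => /andP[_ ltkn].
  apply: reduces_toM.
    apply: reduces_toM (mkR k); apply: reduces_toM (reduces_to_nat _ _) _.
    by apply: reduces_toX; exact: reduces_to_nat.
  by apply: reduces_toD; [|apply: reduces_toN]; apply: reduces_to_harmonic; lia.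
have <- : \sum_(n.+1 <= k < p) (0 : 'F_p) = 0 by rewrite big1.
apply: reduces_to_sum => k; rewrite mem_index_iota => /andP[ltnk ltkp].
have ndvd_fact : (p %| k`!)%N = false.
  by apply/negbTE; rewrite (dvdn_pcharf pcharp); exact: (pchar_fact_neq0 pcharp).
have dvdC : (p %| 'C(2 * k, k))%N.
  have : (p %| (2 * k)`!)%N by rewrite dvdn_fact; lia.
  rewrite -(@bin_fact (2 * k) k); last by lia.
  rewrite (_ : 2 * k - k = k)%N; last by lia.
  by rewrite !Euclid_dvdM // ndvd_fact !orbF.
have C0 : 'C(2 * k, k)%:R = 0 :> 'F_p by apply/eqP; rewrite -(dvdn_pcharf pcharp).
have [c Ec] := dvdnP dvdC.
have [z zR] : exists z : 'F_p, reduces_to (p%:R * (harmonic (2 * k) - harmonic k)) z.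
  have [u uR] := @reduces_to_p_harmonic (2 * k) (ltac:(lia)).
  have [v vR] := @reduces_to_p_harmonic k (ltac:(lia)).
  by exists (u - v); rewrite mulrBr; apply: reduces_toD uR (reduces_toN vR).
(* One factor p of the cube clears the pole of the harmonic difference; another binomial is set
   apart to give the residue 0. *)
have -> : k%:R * 'C(2 * k, k)%:R ^+ 3 / m ^+ k * (harmonic (2 * k) - harmonic k) =
   'C(2 * k, k)%:R * (k%:R * 'C(2 * k, k)%:R * c%:R / m ^+ k *
      (p%:R * (harmonic (2 * k) - harmonic k))).
  move: (m ^+ k)^-1 (_ - _) => mk h.
  have -> : 'C(2 * k, k)%:R ^+ 3 = 'C(2 * k, k)%:R ^+ 2 * (c%:R * p%:R) :> rat.
    by rewrite -natrM -Ec exprSr.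
  by ring.
rewrite -[0 : 'F_p](mul0r ((k%:R * 'C(2 * k, k)%:R * c%:R / mF ^+ k) * z)) -C0.
apply: reduces_toM (reduces_to_nat _ _) _; apply: reduces_toM _ zR.
apply: reduces_toM (mkR k).
by apply: reduces_toM; [apply: reduces_toM|]; apply: reduces_to_nat.
Qed.

Lemma fermat_quotientE : exists2 Q : nat,
  (2 ^ p.-1 = 1 + p * Q)%N & fermat_quotient p 2 = Q%:R.
Proof.
have dvd : (p %| 2 ^ p.-1 - 1)%N.
  have -> : p.-1 = (2 * n)%N by rewrite def_p.
  rewrite (dvdn_pcharf pcharp) natrB ?expn_gt0 // natrX exprM.
  by rewrite (sqr_exp_half p_prime def_p) ?subrr // (two_neq0 pcharp def_p).
have [Q EQ] := dvdnP dvd.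
have EQ2 : (2 ^ p.-1 = 1 + p * Q)%N.
  by rewrite mulnC -EQ subnKC // expn_gt0.
exists Q => //; rewrite /fermat_quotient -natrX EQ2 natrD addrC addKr natrM.
by rewrite mulrC mulKf // pnatr_eq0 -lt0n prime_gt0.
Qed.

End HarmonicReduction.

Theorem corollary4p1 (p : nat) (p_prime : prime p) (p_gt3 : (3 < p)%N) :
  [/\ forall x y : int,
        p%:Z = x ^+ 2 + 2 * y ^+ 2 ->
        eqmod_loc p
          ((legendre (-1) p)%:~R *
             (\sum_(0 <= k < p) k%:R * 'C(2 * k, k)%:R ^+ 3 / (-64) ^+ k *
                (harmonic (2 * k) - harmonic k)) - 1 / 6)
          (- (3 * fermat_quotient p 2 + 2) * x%:~R ^+ 2 / 3),
      p = 5 %[mod 8] \/ p = 7 %[mod 8] ->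
        eqmod_loc p
          ((legendre (-1) p)%:~R *
             (\sum_(0 <= k < p) k%:R * 'C(2 * k, k)%:R ^+ 3 / (-64) ^+ k *
                (harmonic (2 * k) - harmonic k)) - 1 / 6)
          0
    & p = 1 %[mod 4] ->
      forall x y : int,
        p%:Z = x ^+ 2 + y ^+ 2 -> ~~ (2 %| x)%Z -> (2 %| y)%Z ->
        eqmod_loc p
          (\sum_(0 <= k < p) k%:R * 'C(2 * k, k)%:R ^+ 3 / 64 ^+ k *
             (harmonic (2 * k) - harmonic k))
          (- (x%:~R ^+ 2 / 3) * (3 * fermat_quotient p 2 + 2)) ].
Proof.
have [n def_p] : exists n, p = (2 * n).+1.
  have [p2 | odd_p] := even_prime p_prime; first by rewrite p2 in p_gt3.
  by exists p./2; rewrite mul2n -[LHS](odd_double_half p) odd_p.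
have pcharp := pchar_Fp p_prime.
have nz2 : 2 != 0 :> 'F_p := two_neq0 pcharp def_p p_gt3.
have nz4 : 4 != 0 :> 'F_p := four_neq0 pcharp def_p p_gt3.
have nz3 : 3 != 0 :> 'F_p by apply: pchar_natr_neq0 pcharp _.
have nz6 : 6 != 0 :> 'F_p by rewrite (natrM _ 2 3) mulf_neq0.
have nz64 : 64 != 0 :> 'F_p by rewrite (natrX _ 4 3) expf_neq0.
have nzN64 : -64 != 0 :> 'F_p by rewrite oppr_eq0.
have natR m : reduces_to (m%:R) (m%:R : 'F_p) := reduces_to_nat p m.
have natVR m : m%:R != 0 :> 'F_p -> reduces_to (m%:R^-1) (m%:R^-1 : 'F_p).
  by move=> nzm; apply: reduces_toV.
have [Q defQ ->] := fermat_quotientE p_prime def_p p_gt3.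
have negR := reduces_to_binomial_sum p_prime def_p p_gt3 nzN64 (reduces_toN (natR 64%N)).
have posR := reduces_to_binomial_sum p_prime def_p p_gt3 nz64 (natR 64%N).
have lhsR := reduces_toD (reduces_toM (reduces_to_int p (legendre (-1) p)) negR)
  (reduces_toN (reduces_toM (natR 1%N) (natVR 6%N nz6))).
have qR := reduces_toD (reduces_toM (natR 3%N) (natR Q)) (natR 2%N).
have E64 := sum_neg64 p_prime def_p p_gt3 defQ.
have sE : (legendre (-1) p)%:~R = (-1) ^+ n :> 'F_p.
  by rewrite (legendreN1 p_prime def_p p_gt3) rmorphXn rmorphN1.
split.
- move=> x y Ex; apply: (reduces_to_eqmod p_prime lhsR).
  rewrite sE (final_combination_neg nz2 nz3 (sqrr_sign _ n) E64
    (franel_sqr_plus_two_sqr p_prime def_p p_gt3 Ex)).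
  apply: reduces_toM (natVR 3%N nz3); apply: reduces_toM (reduces_toN qR) _.
  exact: reduces_toX (reduces_to_int p x).
- move=> p57; apply: (reduces_to_eqmod p_prime lhsR).
  have f0 := franel_eq0 pcharp def_p p_gt3 p57.
  (* The vanishing case is the same combination with X = 0. *)
  have f0' : franel 'F_p n = (-1) ^+ n * (4 * 0) by rewrite f0 !mulr0.
  rewrite sE (final_combination_neg nz2 nz3 (sqrr_sign _ n) E64 f0') mulr0 mul0r.
  exact: natR 0%N.
move=> p1.
have [m def_n] : exists m, n = (2 * m)%N.
  by exists (p %/ 4)%N; move: p1 def_p; clear; lia.
have even_n : ~~ odd n by rewrite def_n oddM.
have Ep : p = (4 * m).+1 by rewrite def_p def_n; clear; lia.
move=> x y Ex oddx eveny; apply: (reduces_to_eqmod p_prime posR).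
have Eg : dixon_sum 'F_p n = 4 * x%:~R ^+ 2.
  rewrite (dixon_sum_pchar pcharp def_p p_gt3 def_n).
  by have := sum_two_squares_bin p_prime Ep Ex oddx eveny.
rewrite (final_combination_pos nz2 nz3 (sum_pos64 p_prime def_p p_gt3 even_n defQ) Eg).
apply: reduces_toM qR; apply: reduces_toN; apply: reduces_toM (natVR 3%N nz3).
exact: reduces_toX (reduces_to_int p x).
Qed.
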